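(* Let $G\cong\mathbb{Z}_k\rtimes_n\mathbb{Z}_{ql}$ and suppose that $q\nmid l$. Factor $k=2^sx$ with $s\geq 0$ and $2\nmid x$. Let $H=\mathcal{D}(G)$. Then the following are equivalent: (i) There exist $m\in\mathbb{N}$ and an irreducible left $H$-module $V$ with $\nu_m(V)<0$. (ii) There exists an irreducible left $H$-module $W$ with $\nu_2(W)=-1$. (iii) $q=2$, $s\geq 3$, and $n\equiv 2^{s-1}+1$ or $n\equiv 2^{s-1}-1\bmod 2^s$. In general, however, it need not be true that $\nu_m(W)<0$ implies $\nu_2(W)=-1$ for every irreducible $H$-module $W$; that is, there exist such a group $G$ (with $q\nmid l$), an $m\in\mathbb{N}$ and an irreducible $\mathcal{D}(G)$-module $W$ with $\nu_m(W)<0$ and $\nu_2(W)\neq -1$.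
   Context: $\mathbb{N}=\{1,2,3,\dots\}$. Let $k,q,l,n\in\mathbb{N}$ with $q$ a prime dividing $|\mathrm{Aut}(\mathbb{Z}_k)|$, $n^q\equiv 1\bmod k$ and $n\not\equiv 1\bmod k$. Then $\mathbb{Z}_k\rtimes_n\mathbb{Z}_{ql}$ denotes the (non-abelian, order $kql$) group $\langle a,b\mid a^k=b^{ql}=1,\ bab^{-1}=a^n\rangle$. For a finite group $G$, the Drinfel'd double $\mathcal{D}(G)$ is the complex Hopf algebra with basis $\{p_g\bowtie x : g,x\in G\}$, multiplication $(p_g\bowtie x)(p_h\bowtie y)=\delta_{g,xhx^{-1}}\,p_g\bowtie xy$, unit $\sum_g p_g\bowtie 1$, comultiplication $\Delta(p_g\bowtie x)=\sum_{uv=g}(p_u\bowtie x)\otimes(p_v\bowtie x)$ and counit $\epsilon(p_g\bowtie x)=\delta_{g,1}$. Its integral with counit value 1 is $\Lambda=\frac{1}{|G|}\sum_{x\in G}p_1\bowtie x$. Put $\Lambda^{[m]}=\sum\Lambda_1\Lambda_2\cdots\Lambda_m$ (the product of the $m$ tensor factors of the iterated comultiplication of $\Lambda$). For a finite-dimensional $\mathcal{D}(G)$-module $V$ with character $\chi$, the $m$-th indicator is $\nu_m(V)=\chi(\Lambda^{[m]})$. *)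

(* Defs.v *)
From HB Require Import structures.
From mathcomp Require Import all_boot all_order all_fingroup all_algebra.
From mathcomp Require Import complex reals.

Set Implicit Arguments.
Unset Strict Implicit.
Unset Printing Implicit Defensive.

Import GRing.Theory.
Local Open Scope ring_scope.

(* Aut (Zp k) is used since 'Z_k denotes Z/2 when k <= 1, whereas the group   *)
(* Zp k is trivial in that case.                                              *)
Definition semidirect_params (k q l n : nat) : Prop :=
  [/\ [/\ (0 < k)%N, (0 < l)%N & (0 < n)%N],
      prime q,
      (q %| #|Aut (Zp k)|)%N,
      n ^ q = 1 %[mod k]
    & n <> 1 %[mod k]].

Definition is_semidirect (k q l n : nat) (gT : finGroupType) : Prop :=
  ([set: gT] \isog Grp (a : b : a ^+ k, b ^+ (q * l), b * a * b^-1 = a ^+ n))%g.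

Section DrinfeldDouble.

Variables (C : fieldType) (gT : finGroupType).

(* The function f stands for the sum of the f (g, x) *: (p_g >< x).           *)
Definition drinfeld_double : Type := {ffun gT * gT -> C}.

HB.instance Definition _ := Vector.copy drinfeld_double {ffun gT * gT -> C^o}.

Implicit Types (a b c h : drinfeld_double) (g x y z : gT) (u v : gT * gT).

Definition dd_basis u : drinfeld_double := [ffun v => (v == u)%:R].

Definition dd_one : drinfeld_double := \sum_(g : gT) dd_basis (g, 1%g).

Definition dd_mul a b : drinfeld_double :=
  \sum_(u : gT * gT) \sum_(v : gT * gT)
    (a u * b v) *:
    (if u.1 == (u.2 * v.1 * u.2^-1)%g then dd_basis (u.1, (u.2 * v.2)%g) else 0).

Lemma dd_mulE a b g z :
  dd_mul a b (g, z) = \sum_x a (g, x) * b ((x^-1 * g * x)%g, (x^-1 * z)%g).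
Proof.
pose G (u v : gT * gT) : C :=
  a u * b v * ((u.1 == (u.2 * v.1 * u.2^-1)%g) && ((g, z) == (u.1, (u.2 * v.2)%g)))%:R.
have -> : dd_mul a b (g, z) = \sum_u \sum_v G u v.
  rewrite /dd_mul sum_ffunE; apply: eq_bigr => u _.
  rewrite sum_ffunE; apply: eq_bigr => v _; rewrite /G !ffunE.
  by case: eqP => _; rewrite ffunE.
transitivity (\sum_y \sum_x \sum_v G (y, x) v).
  by rewrite (pair_bigA _ (fun y x => \sum_v G (y, x) v)); apply: eq_bigr => -[].
rewrite (bigD1 g) //= [X in _ + X]big1 ?addr0 => [|y yg]; last first.
  apply: big1 => x _; apply: big1 => v _.
  by rewrite /G /= xpair_eqE [g == y]eq_sym (negPf yg) andbF mulr0.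
apply: eq_bigr => x _.
rewrite (bigD1 ((x^-1 * g * x)%g, (x^-1 * z)%g)) //= [X in _ + X]big1 => [|[y y']].
  by rewrite /G /= addr0 !mulgA mulgV !mul1g mulgK !eqxx mulr1.
rewrite /G /= !xpair_eqE => ne; case: andP => [[/eqP e /andP[_ /eqP e']]|]; last first.
  by rewrite mulr0.
by case/negP: ne; rewrite e' e !mulgA !mulVg !mul1g mulgKV !eqxx.
Qed.

Lemma dd_oneE g x : dd_one (g, x) = (x == 1%g)%:R.
Proof.
rewrite /dd_one sum_ffunE (bigD1 g) //= ffunE xpair_eqE eqxx big1 ?addr0 // => y yg.
by rewrite ffunE xpair_eqE [g == y]eq_sym (negPf yg).
Qed.

Lemma dd_mulA : associative dd_mul.
Proof.
move=> a b c; apply/ffunP => -[g z]; rewrite !dd_mulE.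
under eq_bigr do rewrite dd_mulE mulr_sumr.
under [RHS]eq_bigr do rewrite dd_mulE mulr_suml.
rewrite [RHS]exchange_big /=; apply: eq_bigr => x _.
rewrite [RHS](reindex_inj (mulgI x)) /=; apply: eq_bigr => y _.
by rewrite mulrA invMg !mulgA mulVg mul1g.
Qed.

Lemma dd_mul1l : left_id dd_one dd_mul.
Proof.
move=> a; apply/ffunP => -[g z]; rewrite dd_mulE (bigD1 1%g) //= dd_oneE eqxx.
rewrite invg1 !mul1g mulg1 mul1r big1 ?addr0 // => x /negPf xn.
by rewrite dd_oneE xn mul0r.
Qed.

Lemma dd_mul1r : right_id dd_one dd_mul.
Proof.
move=> a; apply/ffunP => -[g z]; rewrite dd_mulE (bigD1 z) //= dd_oneE.
rewrite mulVg eqxx mulr1 big1 ?addr0 // => x xn.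
by rewrite dd_oneE -eq_mulVg1 (negPf xn) mulr0.
Qed.

Lemma dd_mulDl : left_distributive dd_mul +%R.
Proof.
move=> a b c; apply/ffunP => -[g z]; rewrite ffunE !dd_mulE -big_split.
by apply: eq_bigr => x _; rewrite ffunE mulrDl.
Qed.

Lemma dd_mulDr : right_distributive dd_mul +%R.
Proof.
move=> a b c; apply/ffunP => -[g z]; rewrite ffunE !dd_mulE -big_split.
by apply: eq_bigr => x _; rewrite ffunE mulrDr.
Qed.

Lemma dd_one_neq0 : dd_one != 0.
Proof.
apply/eqP => /ffunP/(_ (1%g, 1%g)); rewrite dd_oneE ffunE eqxx.
by move/eqP; rewrite oner_eq0.
Qed.

HB.instance Definition _ := GRing.Zmodule_isNzRing.Build drinfeld_double
  dd_mulA dd_mul1l dd_mul1r dd_mulDl dd_mulDr dd_one_neq0.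

Lemma dd_scalerAl (t : C) a b : t *: (a * b) = t *: a * b.
Proof.
apply/ffunP => -[g z]; rewrite ffunE !dd_mulE scaler_sumr.
by apply: eq_bigr => x _; rewrite ffunE [LHS]mulrA.
Qed.

HB.instance Definition _ :=
  GRing.Lmodule_isLalgebra.Build C drinfeld_double dd_scalerAl.

Lemma dd_scalerAr (t : C) a b : t *: (a * b) = a * (t *: b).
Proof.
apply/ffunP => -[g z]; rewrite ffunE !dd_mulE scaler_sumr.
by apply: eq_bigr => x _; rewrite ffunE [LHS]mulrCA.
Qed.

HB.instance Definition _ :=
  GRing.Lalgebra_isAlgebra.Build C drinfeld_double dd_scalerAr.

Lemma dd_basisM u v :
  dd_basis u * dd_basis v =
  if u.1 == (u.2 * v.1 * u.2^-1)%g then dd_basis (u.1, (u.2 * v.2)%g) else 0.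
Proof.
rewrite [LHS]/(dd_mul _ _) /dd_mul (bigD1 u) //= (bigD1 v) //= !ffunE !eqxx.
rewrite mulr1 scale1r big1 ?addr0 => [|w wv]; last first.
  by rewrite [dd_basis v w]ffunE (negPf wv) mulr0 scale0r.
rewrite big1 ?addr0 // => w wu; apply: big1 => t _.
by rewrite ffunE (negPf wu) mul0r scale0r.
Qed.

Definition dd_counit h : C :=
  \sum_(u : gT * gT) h u * (u.1 == 1%g)%:R.

(* The m-th tensor power, with basis the tensors of the p_g >< x, indexed by  *)
(* m-tuples of pairs (g, x).                                                  *)
Definition dd_tensor (m : nat) : Type := {ffun m.-tuple (gT * gT) -> C^o}.

HB.instance Definition _ m :=
  Vector.copy (dd_tensor m) {ffun m.-tuple (gT * gT) -> C^o}.

Definition dd_tensor_basis m (t : m.-tuple (gT * gT)) : dd_tensor m :=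
  [ffun t' => (t' == t)%:R].

Definition dd_comult h : dd_tensor 2 :=
  \sum_(w : gT * gT) h w *:
    \sum_(uv : gT * gT | (uv.1 * uv.2)%g == w.1)
      dd_tensor_basis [tuple (uv.1, w.2); (uv.2, w.2)].

Definition dd_tensor_cons m u (w : dd_tensor m) : dd_tensor m.+1 :=
  \sum_(t : m.-tuple (gT * gT)) w t *: dd_tensor_basis [tuple of u :: t].

(* Delta^(0) = epsilon and Delta^(m+1) = (id (x) Delta^(m)) o Delta; thus     *)
(* Delta^(m) has m tensor factors and Delta^(1) = id.                         *)
Fixpoint dd_iter_comult (m : nat) (h : drinfeld_double) : dd_tensor m :=
  if m is m'.+1 then
    \sum_(t : 2.-tuple (gT * gT)) dd_comult h t *:
      dd_tensor_cons (tnth t ord0) (dd_iter_comult m' (dd_basis (tnth t ord_max)))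
  else dd_counit h *: dd_tensor_basis [tuple].

Definition dd_tensor_mul m (w : dd_tensor m) : drinfeld_double :=
  \sum_(t : m.-tuple (gT * gT)) w t *: \prod_(u <- t) dd_basis u.

Definition sweedler_power (m : nat) h : drinfeld_double :=
  dd_tensor_mul (dd_iter_comult m h).

Definition dd_integral : drinfeld_double :=
  #|gT|%:R^-1 *: \sum_(x : gT) dd_basis (1%g, x).

Lemma dd_counit_basis u : dd_counit (dd_basis u) = (u.1 == 1%g)%:R.
Proof.
rewrite /dd_counit (bigD1 u) //= ffunE eqxx mul1r big1 ?addr0 // => v vu.
by rewrite ffunE (negPf vu) mul0r.
Qed.

Lemma dd_integralE g z : dd_integral (g, z) = #|gT|%:R^-1 * (g == 1%g)%:R.
Proof.
rewrite ffunE sum_ffunE (bigD1 z) //= ffunE xpair_eqE eqxx andbT.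
rewrite big1 ?addr0 // => y yz.
by rewrite ffunE xpair_eqE [z == y]eq_sym (negPf yz) andbF.
Qed.

Lemma dd_counit_integral : #|gT|%:R != 0 :> C -> dd_counit dd_integral = 1.
Proof.
move=> G0; rewrite /dd_counit.
rewrite (eq_bigr (fun u : gT * gT => #|gT|%:R^-1 * (u.1 == 1%g)%:R)); last first.
  by case=> g z _; rewrite dd_integralE /=; case: (g == _); rewrite !(mulr0, mulr1).
rewrite -(pair_bigA _ (fun g (_ : gT) => #|gT|%:R^-1 * (g == 1%g)%:R)) /=.
rewrite (bigD1 1%g) //= [X in _ + X]big1 => [|g /negPf->]; last first.
  by apply: big1 => _ _; rewrite mulr0.
by rewrite eqxx mulr1 addr0 sumr_const -[LHS]mulr_natl mulfV.
Qed.

Lemma dd_integralP h : h * dd_integral = dd_counit h *: dd_integral.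
Proof.
apply/ffunP => -[g z]; rewrite [LHS]dd_mulE [RHS]ffunE dd_integralE.
rewrite (eq_bigr (fun x => h (g, x) * (#|gT|%:R^-1 * (g == 1%g)%:R))); last first.
  move=> x _; rewrite dd_integralE; congr (_ * (_ * _%:R)).
  by rewrite -(conjg_eq1 g x) /conjg mulgA.
rewrite -mulr_suml /dd_counit.
rewrite [in RHS](eq_bigr (fun u : gT * gT => h (u.1, u.2) * (u.1 == 1%g)%:R)); last by case.
rewrite [_ *: _]/(_ * _).
rewrite -(pair_bigA _ (fun g x => h (g, x) * (g == 1%g)%:R)) /=.
have [->|_] := eqVneq g 1%g; last by rewrite [X in _ = _ * X]mulr0 !mulr0.
rewrite [X in _ = X * _](bigD1 1%g) //= [X in (_ + X) * _]big1 => [|y /negPf->]; last first.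
  by apply: big1 => x _; rewrite mulr0.
by rewrite addr0 eqxx; congr (_ * _); apply: eq_bigr => x _; rewrite mulr1.
Qed.

Lemma sweedler_power0 h : sweedler_power 0 h = dd_counit h *: 1.
Proof.
rewrite /sweedler_power /dd_tensor_mul (bigD1 [tuple]) //= [X in _ + X]big1 => [|t]; last first.
  by rewrite (tuple0 t) => /eqP[].
by rewrite !ffunE eqxx big_nil [X in X *: _]mulr1 addr0.
Qed.

Lemma dd_tensor_mul_lin m (c : C) (w w' : dd_tensor m) :
  dd_tensor_mul (c *: w + w') = c *: dd_tensor_mul w + dd_tensor_mul w'.
Proof.
rewrite /dd_tensor_mul scaler_sumr -big_split; apply: eq_bigr => t _ /=.
by rewrite !ffunE scalerDl scalerA.
Qed.

Lemma dd_tensor_mul0 m : dd_tensor_mul (0 : dd_tensor m) = 0.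
Proof. by apply: big1 => t _; rewrite ffunE scale0r. Qed.

Lemma dd_tensor_mul_sum m I (r : seq I) P (F : I -> dd_tensor m) (c : I -> C) :
  dd_tensor_mul (\sum_(i <- r | P i) c i *: F i) =
  \sum_(i <- r | P i) c i *: dd_tensor_mul (F i).
Proof.
elim: r => [|i r IH]; first by rewrite !big_nil dd_tensor_mul0.
by rewrite !big_cons; case: ifP => _ //; rewrite dd_tensor_mul_lin IH.
Qed.

Lemma dd_tensor_mul_basis m (t : m.-tuple (gT * gT)) :
  dd_tensor_mul (dd_tensor_basis t) = \prod_(u <- t) dd_basis u.
Proof.
rewrite /dd_tensor_mul (bigD1 t) //= ffunE eqxx scale1r [X in _ + X]big1 ?addr0 // => t' n.
by rewrite ffunE (negPf n) scale0r.
Qed.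

Lemma dd_tensor_mul_cons m u (w : dd_tensor m) :
  dd_tensor_mul (dd_tensor_cons u w) = dd_basis u * dd_tensor_mul w.
Proof.
rewrite /dd_tensor_cons dd_tensor_mul_sum {2}/dd_tensor_mul mulr_sumr.
by apply: eq_bigr => t _; rewrite dd_tensor_mul_basis big_cons -scalerAr.
Qed.

Lemma sweedler_powerS m u : sweedler_power m.+1 (dd_basis u) =
  \sum_(g : gT) dd_basis (g, u.2) * sweedler_power m (dd_basis ((g^-1 * u.1)%g, u.2)).
Proof.
rewrite {1}/sweedler_power /= dd_tensor_mul_sum.
rewrite (eq_bigr (fun t : 2.-tuple _ => \sum_(g : gT)
   ((t == [tuple (g, u.2); ((g^-1 * u.1)%g, u.2)])%:R : C) *: (dd_basis (tnth t ord0) *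
      sweedler_power m (dd_basis (tnth t ord_max))))); last first.
  move=> t _; rewrite -scaler_suml dd_tensor_mul_cons; congr (_ *: _).
  rewrite /dd_comult sum_ffunE (bigD1 u) //= [X in _ + X]big1 ?addr0 => [|w wu]; last first.
    by rewrite ffunE ffunE (negPf wu) scale0r.
  rewrite !ffunE eqxx scale1r sum_ffunE.
  rewrite (reindex (fun g => (g, (g^-1 * u.1)%g))) /=; last first.
    exists fst => [//|[y z]]; rewrite inE /= => /eqP <-.
    by rewrite mulgA mulVg mul1g.
  apply: eq_big => [y|y _]; first by rewrite mulgA mulgV mul1g eqxx.
  by rewrite ffunE.
rewrite exchange_big; apply: eq_bigr => g _ /=.
rewrite (bigD1 [tuple (g, u.2); ((g^-1 * u.1)%g, u.2)]) //= eqxx scale1r.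
by rewrite big1 ?addr0 // => t /negPf->; rewrite scale0r.
Qed.

Lemma sweedler_power1 u : sweedler_power 1 (dd_basis u) = dd_basis u.
Proof.
rewrite sweedler_powerS (bigD1 u.1) //= sweedler_power0 dd_counit_basis mulVg eqxx /= scale1r mulr1.
rewrite -surjective_pairing big1 ?addr0 // => g gu.
by rewrite sweedler_power0 dd_counit_basis /= -eq_mulVg1 (negPf gu) scale0r mulr0.
Qed.

End DrinfeldDouble.

(* Finite-dimensional left modules over a C-algebra; in 'End(V) the           *)
(* composition (f \o g)%VF applies g first.                                   *)
Record fdmodule (C : fieldType) (A : algType C) := FdModule {
  fdmod_space : vectType C;
  fdmod_act : {linear A -> 'End(fdmod_space)};
  fdmod_act1 : fdmod_act 1 = \1%VF;
  fdmod_actM : forall x y : A,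
    fdmod_act (x * y) = (fdmod_act x \o fdmod_act y)%VF
}.

Definition irreducible_module (C : fieldType) (A : algType C)
    (V : fdmodule A) : Prop :=
  \dim {:fdmod_space V} <> 0%N /\
  forall U : {vspace fdmod_space V},
    (forall (x : A) (v : fdmod_space V), v \in U -> fdmod_act V x v \in U) ->
    U = 0%VS \/ U = fullv.

Definition lftrace (C : fieldType) (V : vectType C) (f : 'End(V)) : C :=
  \tr (passmx.mxof (vbasis fullv) (vbasis fullv) f).

Definition module_character (C : fieldType) (A : algType C) (V : fdmodule A)
    (x : A) : C :=
  lftrace (fdmod_act V x).

Definition indicator (C : fieldType) (gT : finGroupType) (m : nat)
    (V : fdmodule (drinfeld_double C gT)) : C :=
  module_character V (sweedler_power m (dd_integral C gT)).

(* Main.v *)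
(** A D(G)-module is graded by G, and its m-th indicator is 1/|G| times the sum,
    over the g, x in G with (g x^-1)^m x^m = 1, of the character at p_g >< x^m.
    As q does not divide l, G = A ><| B with A = Z_k x Z_l abelian and B of
    order q.  Write N(z) = (z y)^q for z in A and y in B, y <> 1: this does not
    depend on y, and N is a morphism from A to the centre of G.  For fixed g the
    inner sum splits over the cosets of A, and each part is a nonnegative
    multiple of the character at an idempotent, hence is nonnegative, unless for
    some j there are z, g' in A with N(z)^j = z^(q j) N(g')^j and N(g')^j <> 1.
    On Z_k, N is the multiplication by 1 + n + ... + n^(q-1); on each primary
    part of Z_k this number is 0 or q, and then there are no such z and g',
    except in case (iii).

    In case (iii), a suitable element g outside A is inverted by an x0 in A, its
    centralizer is Z u g Z with Z the centre of G, and Z has a sign character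
    equal to -1 at x0^2.  The irreducible module induced from an extension of
    this character to the centralizer of g has second indicator -1.  Multiplying
    g by a generator c of the factor Z_l moves the value -1 from the second to
    the 2l-th indicator, and kills the second one. *)
From HB Require Import structures.
Require Import Defs.
From mathcomp Require Import all_boot all_order all_fingroup all_algebra.
From mathcomp Require Import cyclic center extremal.
From mathcomp Require Import complex reals.
From mathcomp Require Import zify.

Set Implicit Arguments.
Unset Strict Implicit.
Unset Printing Implicit Defensive.

Import Order.TTheory GRing.Theory Num.Theory.

(** * Characters and indicators *)

Section Trace.
Import passmx.
Local Open Scope ring_scope.

(** Cancelling the full-rank factors in C R C R = C R, for a rank factorization M = C R, gives R C =
    1; and C R has the same trace as R C, the identity of size the rank. *)
Lemma mxtrace_idempotent (F : fieldType) n (M : 'M[F]_n) :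
  M *m M = M -> \tr M = (\rank M)%:R.
Proof.
move=> idM; rewrite -{1}(mulmx_base M) mxtrace_mulC.
suff -> : row_base M *m col_base M = 1%:M by rewrite mxtrace1.
apply: (row_full_inj (col_base_full M)); apply: (row_free_inj (row_base_free M)).
by rewrite mulmx1 mulmx_base mulmxA mulmx_base -mulmxA mulmx_base.
Qed.

Variables (F : fieldType) (V : vectType F).
Implicit Types f g : 'End(V).
Let vb := vbasisP {:V}.

Lemma lftrace_is_scalar : scalar (@lftrace F V).
Proof. by move=> t f g; rewrite /lftrace !linearP. Qed.

Lemma lftrace_comp f g : lftrace (f \o g)%VF = lftrace (g \o f)%VF.
Proof. by rewrite /lftrace !(mxof_comp _ _ vb) mxtrace_mulC. Qed.

Lemma lftrace0 : lftrace (0 : 'End(V)) = 0.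
Proof. by rewrite /lftrace !linear0. Qed.

Lemma lftrace_idempotent f :
  (f \o f)%VF = f -> exists r : nat, lftrace f = r%:R.
Proof.
move=> ff; exists (\rank (mxof (vbasis fullv) (vbasis fullv) f)).
by apply: mxtrace_idempotent; rewrite -(mxof_comp _ _ vb) ff.
Qed.

Lemma lftrace_line f (e : V) t : e != 0 ->
  (forall v, f v \in <[e]>%VS) -> f e = t *: e -> lftrace f = t.
Proof.
move=> e0 fV fe; rewrite /lftrace.
set M := mxof _ _ f; pose u := rVof (vbasis fullv) e.
have u0 : u != 0 by rewrite (rVof_eq0 vb).
have uM : u *m M = t *: u by rewrite -(rVof_app _ vb) fe linearZ.
have [c cM] : exists c, M = c *m u.
  apply/submxP/row_subP => i; rewrite rowE mul_mxof.
  have /vlineP[k ->] := fV (vecof (vbasis fullv) (delta_mx 0 i)).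
  by rewrite linearZ scalemx_sub.
have : u *m c *m u = t%:M *m u by rewrite -mulmxA -cM uM mul_scalar_mx.
rewrite [u *m c]mx11_scalar !mul_scalar_mx => /eqP.
rewrite -subr_eq0 -scalerBl scaler_eq0 (negPf u0) orbF subr_eq0 => /eqP E.
by rewrite cM mxtrace_mulC [u *m c]mx11_scalar E mxtrace_scalar.
Qed.
End Trace.

(** * Characters of modules over an algebra *)

Section Character.
Local Open Scope ring_scope.
Variables (F : fieldType) (A : algType F) (V : fdmodule A).
Notation chi := (module_character V).

Lemma module_character_is_scalar : scalar chi.
Proof.
by move=> t a b; rewrite /module_character linearP /= lftrace_is_scalar.
Qed.
HB.instance Definition _ := GRing.isSemilinear.Build F A F *%R chi
  (GRing.semilinear_linear module_character_is_scalar).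

Lemma module_characterM a b : chi (a * b) = chi (b * a).
Proof. by rewrite /module_character !fdmod_actM lftrace_comp. Qed.

Lemma module_character_idempotent a : a * a = a -> exists r : nat, chi a = r%:R.
Proof. by move=> aa; apply: lftrace_idempotent; rewrite -fdmod_actM aa. Qed.
End Character.

(** * Sweedler powers of basis elements and of the integral *)

Section SweedlerPower.
Local Open Scope ring_scope.
Variables (F : fieldType) (gT : finGroupType).
Implicit Types g h x y : gT.
Notation B g x := (dd_basis F (g%g, x%g)).

Lemma sweedler_power_is_linear m : linear (@sweedler_power F gT m).
Proof.
move=> t a b; case: m => [|m].
  rewrite !sweedler_power0 scalerA -scalerDl; congr (_ *: _).
  rewrite /dd_counit mulr_sumr -big_split; apply: eq_bigr => u _ /=.
  by rewrite !ffunE mulrDl mulrA.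
rewrite /sweedler_power /= !dd_tensor_mul_sum scaler_sumr -big_split.
apply: eq_bigr => u _ /=; rewrite scalerA -scalerDl; congr (_ *: _).
rewrite /dd_comult !sum_ffunE mulr_sumr -big_split; apply: eq_bigr => w _ /=.
by rewrite !ffunE /= [LHS]mulrDl mulrA.
Qed.
HB.instance Definition _ m := GRing.isSemilinear.Build F (drinfeld_double F gT)
  (drinfeld_double F gT) *:%R (@sweedler_power F gT m)
  (GRing.semilinear_linear (sweedler_power_is_linear m)).

Lemma dd_basis_pairM g x h y :
  B g x * B h y = if (g == x * h * x^-1)%g then B g (x * y) else 0.
Proof. exact: dd_basisM. Qed.

(** Comultiplication splits [h] into factors g_1, ..., g_m, and the product of the p_(g_i) >< x
    vanishes unless each g_(i+1) is g_i conjugated by [x]. Only g = g_1 remains free, and h = g g^x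
    g^(x^2) ... = (g x^-1)^m x^m. *)
Lemma sweedler_power_basis m h x :
  sweedler_power m (B h x) = \sum_(g | ((g * x^-1) ^+ m * x ^+ m == h)%g) B g (x ^+ m).
Proof.
elim: m h => [|m IH] h.
  rewrite sweedler_power0 dd_counit_basis /=.
  under eq_bigl do rewrite !expg0 mulg1 eq_sym.
  case: eqP => _; last by rewrite scale0r big1.
  by rewrite scale1r; apply: eq_bigr.
rewrite sweedler_powerS [RHS]big_mkcond; apply: eq_bigr => g _ /=.
rewrite IH mulr_sumr big_mkcond (bigD1 (g ^ x)%g) //= big1 => [|g' ng]; last first.
  case: ifP => // _; rewrite dd_basis_pairM ifN //; apply: contra ng => /eqP->.
  by rewrite conjgE !mulgA mulVg mul1g mulgKV.
rewrite addr0 dd_basis_pairM.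
have -> : (x * g ^ x * x^-1 = g)%g by rewrite conjgE !mulgA mulgV mul1g mulgK.
have -> : (g ^ x * x^-1 = (g * x^-1) ^ x)%g.
  by rewrite !conjgE !mulgA mulgKV mulgK.
rewrite eqxx -expgS -conjXg conjgE -!mulgA -expgS.
congr (if _ then _ else _); apply/eqP/eqP => [E|<-].
  by rewrite expgS -!mulgA E !mulgA mulgV mul1g.
by rewrite [in RHS]expgS -!mulgA mulKg.
Qed.

Lemma sweedler_power_integral m : sweedler_power m (dd_integral F gT) =
  #|gT|%:R^-1 *: \sum_g \sum_(x | ((g * x^-1) ^+ m * x ^+ m == 1)%g) B g (x ^+ m).
Proof.
rewrite /dd_integral linearZ; congr (_ *: _).
rewrite [LHS](linear_sum (@sweedler_power F gT m)).
under eq_bigr do rewrite /= sweedler_power_basis big_mkcond.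
by rewrite exchange_big; apply: eq_bigr => g _ /=; rewrite [RHS]big_mkcond.
Qed.

End SweedlerPower.

(** * Contribution of each degree to the indicator *)

Section Indicators.
Local Open Scope ring_scope.
Variables (F : numFieldType) (gT : finGroupType).
Variable V : fdmodule (drinfeld_double F gT).
Implicit Types (g x y : gT).
Notation B g x := (dd_basis F (g%g, x%g)).
Notation chi := (module_character V).

Definition local_indicator m g : F :=
  \sum_(x | ((g * x^-1) ^+ m * x ^+ m == 1)%g) chi (B g (x ^+ m)).

Lemma indicatorE m : indicator m V = #|gT|%:R^-1 * \sum_g local_indicator m g.
Proof.
rewrite /indicator sweedler_power_integral linearZ /= linear_sum; congr (_ * _).
by apply: eq_bigr => g _; rewrite linear_sum.
Qed.

(** Split p_g >< x as (p_g >< y) (p_(g^y) >< y^-1 x); exchanging the two factors under the trace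
    conjugates both entries by [y]. *)
Lemma char_dd_basisJ g x y : commute g x -> chi (B (g ^ y) (x ^ y)) = chi (B g x).
Proof.
move=> gx; have xg : commute x g by [].
have -> : B g x = B g y * B (g ^ y) (y^-1 * x).
  by rewrite dd_basis_pairM conjgE !mulgA mulgV mul1g mulgK eqxx mul1g.
rewrite module_characterM dd_basis_pairM !conjgE invMg invgK.
rewrite ifT ?mulgA //; apply/eqP.
by rewrite -(mulgA _ x g) xg !mulgA mulgK.
Qed.

(** As [phi] maps into the centralizer of [g], the average of the p_g >< phi(k) is an idempotent,
    and its trace is a natural number. *)
Lemma char_dd_sum_group (kT : finGroupType) (K : {group kT}) (phi : kT -> gT) g :
  {in K &, {morph phi : x y / x * y >-> x * y}}%g ->
  {in K, forall k, commute g (phi k)} ->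
  0 <= \sum_(k in K) chi (B g (phi k)).
Proof.
move=> phiM gphi; pose e := #|K|%:R^-1 *: \sum_(k in K) B g (phi k).
have K0 : #|K|%:R != 0 :> F by rewrite pnatr_eq0 -lt0n cardG_gt0.
have ee : e * e = e.
  rewrite /e -scalerAl -scalerAr; congr (_ *: _).
  rewrite mulr_suml (eq_bigr (fun=> \sum_(k in K) B g (phi k))) => [|k Kk].
    by rewrite sumr_const -scaler_nat scalerA mulVf // scale1r.
  rewrite mulr_sumr [RHS](reindex_inj (mulgI k)) /=.
  apply: eq_big => [k'|k' Kk']; first by rewrite groupMl.
  by rewrite dd_basis_pairM -(gphi _ Kk) mulgK eqxx phiM.
have [r chie] := module_character_idempotent V ee.
have -> : \sum_(k in K) chi (B g (phi k)) = #|K|%:R * chi e.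
  by rewrite /e linearZ /= mulrA mulfV // mul1r linear_sum.
by rewrite chie -natrM ler0n.
Qed.

(** Conjugation by psi(l) permutes the phi(k), so the averages over [K] and over [L] are commuting
    idempotents, and their product is again an idempotent. *)
Lemma char_dd_sum_group2 (kT lT : finGroupType) (K : {group kT}) (L : {group lT})
    (phi : kT -> gT) (psi : lT -> gT) (act : lT -> {perm kT}) g :
  {in K &, {morph phi : x y / x * y >-> x * y}}%g ->
  {in L &, {morph psi : x y / x * y >-> x * y}}%g ->
  {in K, forall k, commute g (phi k)} -> {in L, forall l, commute g (psi l)} ->
  (forall l k, l \in L -> k \in K -> act l k \in K) ->
  {in L & K, forall l k, psi l * phi k = phi (act l k) * psi l}%g ->
  0 <= \sum_(k in K) \sum_(l in L) chi (B g (phi k * psi l)).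
Proof.
move=> phiM psiM gphi gpsi actK psiphi.
pose e := \sum_(k in K) B g (phi k).
pose f := \sum_(l in L) B g (psi l).
have gM k k' : commute g k -> B g k * B g k' = B g (k * k').
  by move=> gk; rewrite dd_basis_pairM -gk mulgK eqxx.
have ee : e * e = #|K|%:R *: e.
  rewrite {1}/e mulr_suml (eq_bigr (fun=> e)) => [|k Kk].
    by rewrite sumr_const scaler_nat.
  rewrite mulr_sumr [RHS](reindex_inj (mulgI k)) /=.
  apply: eq_big => [k'|k' Kk']; first by rewrite groupMl.
  by rewrite gM ?phiM //; apply: gphi.
have ff : f * f = #|L|%:R *: f.
  rewrite {1}/f mulr_suml (eq_bigr (fun=> f)) => [|k Kk].
    by rewrite sumr_const scaler_nat.
  rewrite mulr_sumr [RHS](reindex_inj (mulgI k)) /=.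
  apply: eq_big => [k'|k' Kk']; first by rewrite groupMl.
  by rewrite gM ?psiM //; apply: gpsi.
have efE : e * f = \sum_(k in K) \sum_(l in L) B g (phi k * psi l).
  rewrite mulr_suml; apply: eq_bigr => k Kk; rewrite mulr_sumr.
  by apply: eq_bigr => l Ll; rewrite gM //; apply: gphi.
have fe : f * e = e * f.
  rewrite efE exchange_big mulr_suml; apply: eq_bigr => l Ll; rewrite mulr_sumr.
  rewrite [RHS](reindex_inj (@perm_inj _ (act l))) /=.
  have imK : act l @: K = K.
    apply/eqP; rewrite eqEcard card_imset ?leqnn ?andbT; last exact: perm_inj.
    by apply/subsetP => _ /imsetP[k Kk ->]; apply: actK.
  apply: eq_big => [k|k Kk]; first by rewrite -{2}imK mem_imset //; apply: perm_inj.
  by rewrite gM ?psiphi //; apply: gpsi.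
pose c : F := (#|K| * #|L|)%:R.
have c0 : c != 0 by rewrite pnatr_eq0 -lt0n muln_gt0 !cardG_gt0.
have [] := @module_character_idempotent _ _ V (c^-1 *: (e * f)).
  rewrite -scalerAl -scalerAr; congr (_ *: _).
  have -> : e * f * (e * f) = (e * e) * (f * f).
    by rewrite mulrA -[e * f * e]mulrA fe !mulrA.
  by rewrite ee ff -scalerAl -scalerAr !scalerA -mulrA -natrM mulVf // scale1r.
move=> r E; have -> : \sum_(k in K) \sum_(l in L) chi (B g (phi k * psi l)) =
    c * chi (c^-1 *: (e * f)).
  rewrite linearZ /= mulrA mulfV // mul1r efE linear_sum.
  by apply: eq_bigr => k _; rewrite linear_sum.
by rewrite E -natrM ler0n.
Qed.

(** The condition makes x^m the inverse of (g x^-1)^m; so x^m commutes with g x^-1 and with x, hence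
    with their product g. *)
Lemma indicator_cond_commute m g x :
  ((g * x^-1) ^+ m * x ^+ m = 1)%g -> commute g (x ^+ m)%g.
Proof.
move=> E; have c1 : commute (g * x^-1)%g (x ^+ m)%g.
  have -> : (x ^+ m = ((g * x^-1) ^+ m)^-1)%g.
    by apply/eqP; rewrite eq_sym eq_invg_mul E.
  exact/commuteV/commuteX.
have := commuteM (commute_sym c1) (commute_sym (commuteX m (commute_refl x))).
by rewrite mulgKV => /commute_sym.
Qed.

Lemma local_indicatorJ m g y : local_indicator m (g ^ y)%g = local_indicator m g.
Proof.
rewrite /local_indicator (reindex_inj (@conjg_inj _ y)) /=.
have condE x : ((g ^ y * (x ^ y)^-1) ^+ m * (x ^ y) ^+ m = ((g * x^-1) ^+ m * x ^+ m) ^ y)%g.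
  by rewrite -conjVg -conjMg -!conjXg -conjMg.
apply: eq_big => [x|x]; first by rewrite condE conjg_eq1.
rewrite condE conjg_eq1 => /eqP/indicator_cond_commute E.
by rewrite -conjXg char_dd_basisJ.
Qed.
End Indicators.

(** * Nonnegativity of the indicators *)

Section SdprodSum.
Local Open Scope ring_scope.
Variables (gT : finGroupType) (A B : {group gT}).
Hypothesis sdG : (A ><| B)%g = [set: gT].

Lemma big_sdprod (R : nmodType) (P : pred gT) (f : gT -> R) :
  \sum_(x | P x) f x = \sum_(y in B) \sum_(z in A | P (z * y)%g) f (z * y)%g.
Proof.
have [_ defG _ tiAB] := sdprodP sdG.
rewrite (exchange_big_dep (mem A)) /=; last by move=> y z _ /andP[].
rewrite (pair_big_dep (mem A) (fun z y => (y \in B) && ((z \in A) && P (z * y)%g))) /=.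
rewrite (reindex_onto (fun p : gT * gT => (p.1 * p.2)%g)
   (fun x => (divgr A B x, remgr A B x))) /=; last first.
  by move=> x _; rewrite -divgr_eq.
apply: eq_bigl => -[z y] /=.
have [Az|nAz] := boolP (z \in A); last first.
  apply/negbTE/negP => /andP[_ /eqP[E _]]; case/negP: nAz; rewrite -E.
  by apply: mem_divgr; rewrite defG inE.
have [By|nBy] := boolP (y \in B); last first.
  rewrite /=; apply/negbTE/negP => /andP[_ /eqP[_ E]]; case/negP: nBy; rewrite -E.
  by apply: mem_remgr; rewrite defG inE.
by rewrite divgrMid // remgrMid // eqxx andbT.
Qed.
End SdprodSum.

(** * Nonnegativity for [A ><| B] with [A] abelian and [B] of prime order *)

Section Nonneg.
Variables (F : numFieldType) (gT : finGroupType).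
Variable V : fdmodule (drinfeld_double F gT).
Variables (A B : {group gT}) (q : nat) (N : gT -> gT).
Notation chi := (module_character V).
Notation bas g x := (dd_basis F (g%g, x%g)).
Local Open Scope group_scope.

Hypotheses (sdG : A ><| B = [set: gT]) (abA : abelian A).
Hypotheses (prq : prime q) (oB : #|B| = q).
Hypothesis NM : {in A &, {morph N : x y / x * y}}.
Hypothesis NA : {in A, forall z, N z \in A}.
Hypothesis Ncent : {in A, forall z x, commute x (N z)}.
Hypothesis Npow : forall z y, z \in A -> y \in B -> y != 1 -> (z * y) ^+ q = N z.
(* The only hypothesis that fails in the exceptional case (iii). *)
Hypothesis Nsolv : forall j z g, z \in A -> g \in A ->
  N z ^+ j = z ^+ (q * j) * N g ^+ j -> N g ^+ j = 1.
Hypothesis powJ : forall m z y, ~~ (q %| m)%N -> z \in A -> y \in B -> y != 1 ->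
  exists w, (z * y) ^+ m = (z ^+ m * y ^+ m) ^ w.

Let AJ x z : z \in A -> z ^ x \in A.
Proof.
case/sdprod_context: sdG => /andP[_ nA] _ _ _ _ Az.
by rewrite memJ_norm // (subsetP nA) ?inE.
Qed.

Let cA z w : z \in A -> w \in A -> commute z w.
Proof. by move=> Az Aw; apply: (centsP abA). Qed.

Let NX z j : z \in A -> N z ^+ j \in A.
Proof. by move=> Az; rewrite groupX ?NA. Qed.

Let N1 : N 1 = 1.
Proof. by apply: (mulgI (N 1)); rewrite -NM ?group1 // !mulg1. Qed.

Let NV z : z \in A -> N z^-1 = (N z)^-1.
Proof. by move=> Az; apply/eqP; rewrite eq_sym eq_invg_mul -NM ?groupV // mulgV N1. Qed.

Let NJ z y : z \in A -> y \in B -> N (z ^ y) = N z.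
Proof.
move=> Az By; have [->|y1] := eqVneq y 1; first by rewrite conjg1.
have -> : N z = N z ^ y by rewrite /conjg -(Ncent Az y) mulKg.
rewrite -(Npow Az By y1) -(Npow (AJ y Az) By y1) conjXg conjMg.
by rewrite [y ^ y]conjgE mulKg.
Qed.

Let expM z w j : z \in A -> w \in A -> (z * w) ^+ j = z ^+ j * w ^+ j.
Proof. by move=> Az Aw; apply: expgMn; apply: cA. Qed.

(** The form in which a coset of [A] is treated below: the condition cuts out a subgroup [K], on
    which the group element [f z] follows a morphism [phi]. *)
Lemma dd_sum_ge0 (P : pred gT) (K : {group gT}) (f phi : gT -> gT) g :
  (forall z, z \in A -> P z = (z \in K)) -> K \subset A ->
  {in K, forall z, f z = phi z} ->
  {in K &, {morph phi : x y / x * y}} -> {in K, forall z, commute g (phi z)} ->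
  (0 <= \sum_(z in A | P z) chi (bas g (f z)))%R.
Proof.
move=> PK sKA fphi phiM gphi.
rewrite (eq_big (mem K) (fun z => chi (bas g (phi z)))); first exact: char_dd_sum_group.
  move=> z /=; have [Az|nAz] := boolP (z \in A); first by rewrite PK.
  by apply/esym/negbTE; apply: contra nAz; apply: (subsetP sKA).
by move=> z /andP[Az]; rewrite PK // => Kz; rewrite fphi.
Qed.

Lemma dd_sum_empty_ge0 (P : pred gT) (f : gT -> gT) g :
  (forall z, z \in A -> P z = false) ->
  (0 <= \sum_(z in A | P z) chi (bas g (f z)))%R.
Proof. by move=> P0; rewrite big1 // => z /andP[/P0->]. Qed.

Lemma local_sum_A_ge0 m g : g \in A ->
  (0 <= \sum_(z in A | ((g * z^-1) ^+ m * z ^+ m == 1)%g) chi (bas g (z ^+ m)))%R.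
Proof.
move=> Ag; have condE z : z \in A -> ((g * z^-1) ^+ m * z ^+ m == 1) = (g ^+ m == 1).
  by move=> Az; rewrite expM ?groupV // expgVn mulgKV.
have [gm|gm] := boolP (g ^+ m == 1); last first.
  by apply: dd_sum_empty_ge0 => z Az; rewrite condE // (negPf gm).
apply: (@dd_sum_ge0 _ A _ (fun z => z ^+ m)) => //.
- by move=> z Az; rewrite condE // Az.
- by move=> z w Az Aw; apply: expM.
by move=> z Az; apply: cA; rewrite ?groupX.
Qed.

(** For g = g0 t with t <> 1 and N(g0)^j = 1, this is the solution set of the indicator condition on
    the coset [A] and, after a change of variable, on the coset of t. *)
Lemma kerN_group_set j : group_set [set z in A | N z ^+ j == z ^+ (q * j)].
Proof.
apply/group_setP; split=> [|x y]; first by rewrite inE group1 N1 !expg1n eqxx.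
rewrite !inE => /andP[Ax /eqP Ex] /andP[Ay /eqP Ey].
by rewrite groupM //= NM // !expM ?NA // Ex Ey.
Qed.
Let kerN j := Group (kerN_group_set j).

Let kerNsub j : kerN j \subset A.
Proof. by apply/subsetP => z; rewrite inE => /andP[]. Qed.

(** Write g = g0 t and let x run through the coset [A y]. If t = y = 1, the condition is g^(q j) =
    1. If y is neither 1 nor t, both powers are values of N and the condition is N(g0)^j = 1. In the
    other cases it is the equation of [Nsolv], which forces N(g0)^j = 1 and leaves the subgroup
    [kerN j]. *)
Lemma local_indicator_dvd_ge0 j g : (0 <= local_indicator V (q * j) g)%R.
Proof.
have [g0 [t [Ag0 Bt Eg _]]] := mem_sdprod sdG (in_setT g).
rewrite /local_indicator (big_sdprod sdG); apply: sumr_ge0 => y By.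
have powE z u : z \in A -> u \in B -> u != 1 -> (g0 * u * z^-1) ^+ q = N g0 * (N z)^-1.
  move=> Az Bu u1; rewrite -mulgA -(mulKVg u (u * z^-1)).
  have -> : g0 * (u * (u^-1 * (u * z^-1))) = g0 * z^-1 ^ u^-1 * u.
    by rewrite conjgE invgK !mulgA mulgKV mulgKV.
  have Azu : z^-1 ^ u^-1 \in A by rewrite AJ ?groupV.
  by rewrite Npow ?(groupM Ag0 Azu) // NM // NJ ?groupV // NV.
have solvE z : z \in A -> (N g0 * (N z)^-1) ^+ j * z ^+ (q * j) = 1 ->
    N z ^+ j = z ^+ (q * j) * N g0 ^+ j.
  move=> Az; rewrite expM ?groupV ?NA // expgVn.
  move=> /(congr1 (fun u => u * z ^- (q * j) * N z ^+ j)).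
  by rewrite mulgK mulgKV mul1g => ->; rewrite mulKVg.
have [y1|y1] := eqVneq y 1.
  rewrite y1; under eq_bigl do rewrite mulg1; under eq_bigr do rewrite mulg1.
  have [t1|t1] := eqVneq t 1; first by apply: local_sum_A_ge0; rewrite Eg t1 mulg1.
  have condE z : z \in A -> (g * z^-1) ^+ (q * j) * z ^+ (q * j) =
      (N g0 * (N z)^-1) ^+ j * z ^+ (q * j).
    by move=> Az; rewrite expgM Eg powE.
  have [gj|gj] := eqVneq (N g0 ^+ j) 1; last first.
    apply: dd_sum_empty_ge0 => z Az; apply/negbTE; apply: contra gj => /eqP.
    rewrite condE // => /(solvE _ Az) E; apply/eqP; exact: Nsolv E.
  apply: (@dd_sum_ge0 _ (kerN j) _ (fun z => z ^+ (q * j))) => //.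
  - move=> z Az; rewrite condE // !inE Az /= expM ?groupV ?NA // gj mul1g expgVn.
    by rewrite -eq_invg_mul invgK.
  - by move=> z w /(subsetP (kerNsub j)) Az /(subsetP (kerNsub j)); apply: expM.
  by move=> z; rewrite inE => /andP[Az /eqP <-]; apply: commuteX; apply: Ncent.
have xpowE z : z \in A -> (z * y) ^+ (q * j) = N z ^+ j.
  by move=> Az; rewrite expgM Npow.
have [ty|ty] := eqVneq t y; last first.
  have condE z : z \in A ->
      (g * (z * y)^-1) ^+ (q * j) * (z * y) ^+ (q * j) = N g0 ^+ j.
    move=> Az; rewrite xpowE // expgM Eg invMg mulgA -(mulgA g0) powE //; last 2 first.
    - by rewrite groupM ?groupV.
    - by rewrite -eq_mulgV1.
    by rewrite expM ?groupV ?NA // expgVn mulgKV.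
  have [gj|gj] := eqVneq (N g0 ^+ j) 1; last first.
    by apply: dd_sum_empty_ge0 => z Az; rewrite condE // (negPf gj).
  apply: (@dd_sum_ge0 _ A _ (fun z => N z ^+ j)) => //.
  - by move=> z Az; rewrite condE // gj eqxx Az.
  - by move=> z w Az Aw; rewrite NM // expM ?NA.
  by move=> z Az; apply: commuteX; apply: Ncent.
(* x = w^-1 g exchanges x and g x^-1 up to conjugation, so the coset A y of g
   contributes as A does. *)
pose h w := w^-1 * g0.
rewrite (reindex_inj (h := h)); last by move=> u v /mulIg/invg_inj.
have hA w : (h w \in A) = (w \in A) by rewrite groupMr // groupV.
under eq_bigl do rewrite hA.
have hE w : g * (h w * y)^-1 = w.
  by rewrite Eg ty /h !invMg invgK !mulgA mulgK mulgV mul1g.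
have xE w : w \in A -> (h w * y) ^+ (q * j) = (N g0 * (N w)^-1) ^+ j.
  move=> Aw; rewrite xpowE ?hA // NM ?groupV // NV //.
  by rewrite (cA (NA Ag0)) ?groupV ?NA.
have condE w : w \in A -> (g * (h w * y)^-1) ^+ (q * j) * (h w * y) ^+ (q * j) =
   (N g0 * (N w)^-1) ^+ j * w ^+ (q * j).
  move=> Aw; rewrite hE xE //.
  by apply: cA; rewrite groupX // groupM ?groupV ?NA.
have [gj|gj] := eqVneq (N g0 ^+ j) 1; last first.
  apply: dd_sum_empty_ge0 => z Az; apply/negbTE; apply: contra gj => /eqP.
  rewrite condE // => /(solvE _ Az) E; apply/eqP; exact: Nsolv E.
apply: (@dd_sum_ge0 _ (kerN j) _ (fun z => (N z ^+ j)^-1)) => //.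
- move=> z Az; rewrite condE // !inE Az /= expM ?groupV ?NA // gj mul1g expgVn.
  by rewrite -eq_invg_mul invgK.
- move=> z /(subsetP (kerNsub j)) Az.
  by rewrite xE // expM ?groupV ?NA // gj mul1g expgVn.
- move=> z w /(subsetP (kerNsub j)) Az /(subsetP (kerNsub j)) Aw.
  by rewrite NM // expM ?NA // -invMg; congr (_^-1); apply: cA; rewrite NX.
by move=> z /(subsetP (kerNsub j)) Az; apply/commuteV/commuteX/Ncent.
Qed.

Lemma pow_neq1 m y : ~~ (q %| m)%N -> y \in B -> y != 1 -> y ^+ m != 1.
Proof.
move=> qm By; apply: contra => /eqP ym.
have cop : coprime #|B| m by rewrite oB prime_coprime.
by rewrite -(expgK cop By) ym expg1n.
Qed.

(** Modulo [A] the condition gives g^m = 1, so g lies in [A]. For central g the sum is empty or runs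
    over the whole group, where it factors through averages over [A] and [B]. For other g only x in
    [A] contribute: a solution outside [A] would put a nontrivial element of [B], hence all of [B],
    into the centralizer of g. *)
Lemma local_indicator_ndvd_ge0 m g : ~~ (q %| m)%N -> (0 <= local_indicator V m g)%R.
Proof.
move=> qm; have [g0 [t [Ag0 Bt Eg _]]] := mem_sdprod sdG (in_setT g).
have [nsAG sBG _ _ tiAB] := sdprod_context sdG.
have cop : coprime #|B| m by rewrite oB prime_coprime.
have abQ : abelian ([set: gT] / A).
  rewrite -(isog_abelian (sdprod_isog sdG)).
  by apply: cyclic_abelian; apply: prime_cyclic; rewrite oB.
have nA x : x \in 'N(A) by rewrite (subsetP (normal_norm nsAG)) ?inE.
have condA x : (g * x^-1) ^+ m * x ^+ m = 1 -> g ^+ m \in A.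
  move=> /(congr1 (coset A)); rewrite morph1 morphM ?morphX ?nA // morphM ?morphV ?nA //.
  have Q y : coset A y \in [set: gT] / A by rewrite mem_quotient ?inE.
  rewrite expgMn; last by apply: (centsP abQ); rewrite ?groupV ?Q.
  by rewrite expgVn mulgKV -morphX ?nA //; apply: coset_idr.
have Am z y : z \in A -> exists2 w, w \in A & (z * y) ^+ m = w * y ^+ m.
  move=> Az; elim: {+}m => [|r [w Aw IH]]; first by exists 1; rewrite ?mulg1.
  exists (w * z ^ (y ^- r)); first by rewrite groupM ?(AJ _ Az).
  by rewrite expgSr IH conjgE invgK [in RHS]expgSr !mulgA mulgKV.
have [t1|t1] := eqVneq t 1; last first.
  rewrite /local_indicator big1 // => x /eqP/condA.
  rewrite Eg; have [w Aw ->] := Am g0 t Ag0; rewrite groupMl // => Atm.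
  case/negP: (pow_neq1 qm Bt t1); rewrite -in_set1 -[[set 1]]tiAB inE Atm.
  by rewrite groupX.
have Ag : g \in A by rewrite Eg t1 mulg1.
have [cg|ncg] := boolP [forall x, g * x == x * g].
  have cgx x : commute g x by apply/eqP/(forallP cg).
  have condE x : ((g * x^-1) ^+ m * x ^+ m == 1) = (g ^+ m == 1).
    by rewrite expgMn ?expgVn ?mulgKV //; apply: cgx.
  have [gm|gm] := eqVneq (g ^+ m) 1; last first.
    by rewrite /local_indicator big1 // => x; rewrite condE (negPf gm).
  (* (z y)^m is conjugate to z^m y^m, and y |-> y^m permutes B. *)
  have -> : local_indicator V m g =
      (\sum_(z in A) \sum_(y in B) chi (bas g (z ^+ m * y)))%R.
    rewrite /local_indicator (big_sdprod sdG) [RHS]exchange_big /=.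
    rewrite [RHS](reindex_onto (fun y => y ^+ m) (fun y => y ^+ expg_invn B m)) /=.
      apply: eq_big => [y|y By].
        have [By|nBy] := boolP (y \in B); first by rewrite groupX //= expgK ?eqxx.
        apply/esym/negbTE; apply: contra nBy => /andP[Bym /eqP <-]; exact: groupX.
      apply: eq_big => [z|z /andP[Az _]]; first by rewrite condE gm eqxx andbT.
      have [->|y1] := eqVneq y 1; first by rewrite mulg1 expg1n mulg1.
      have [w ->] := powJ qm Az By y1.
      have {1}-> : g = g ^ w by rewrite /conjg (cgx w) mulKg.
      by rewrite char_dd_basisJ.
    by move=> y By; rewrite -expgM mulnC expgM expgK.
  have actP (y : gT) : injective (conjg^~ y^-1) by exact: conjg_inj.
  apply: (@char_dd_sum_group2 _ _ _ _ _ A B (fun z => z ^+ m) id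
    (fun y => perm (@actP y))) => //.
  - by move=> z w Az Aw; apply: expM.
  - by move=> y z _ Az; rewrite permE AJ.
  by move=> y z _ _; rewrite permE -conjXg conjgE invgK !mulgA mulgKV.
rewrite /local_indicator (big_sdprod sdG) (bigD1 1) ?group1 //=.
rewrite [X in (_ + X)%R]big1 ?addr0 => [|y /andP[By y1]].
  under eq_bigl do rewrite mulg1; under eq_bigr do rewrite mulg1.
  exact: local_sum_A_ge0.
rewrite big1 // => z /andP[Az /eqP E]; case/negP: ncg; apply/forallP => x; apply/eqP.
have cx := indicator_cond_commute E.
have cy : y \in 'C[g].
  have [w Aw Ew] := Am z y Az; rewrite -(expgK cop By) groupX //.
  have -> : y ^+ m = w^-1 * (z * y) ^+ m by rewrite Ew mulKg.
  by rewrite groupM ?groupV //; apply/cent1P; rewrite // ; apply: cA.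
have /subsetP cB : B \subset 'C[g].
  apply: prime_meetG; rewrite ?oB //; apply/trivgPn; exists y => //.
  by rewrite inE By.
have [u [v [Au Bv -> _]]] := mem_sdprod sdG (in_setT x).
by apply: commuteM; [apply: cA | apply/commute_sym/cent1P; apply: cB].
Qed.

Lemma indicator_ge0 m : (0 <= indicator m V)%R.
Proof.
rewrite indicatorE mulr_ge0 ?invr_ge0 ?ler0n // sumr_ge0 // => g _.
have [/dvdnP[j ->]|qm] := boolP (q %| m)%N; last exact: local_indicator_ndvd_ge0.
by rewrite mulnC local_indicator_dvd_ge0.
Qed.

End Nonneg.

(** * The semidirect product *)

Section GeometricSum.
Local Open Scope nat_scope.

(** The exponent met in powers: if b a b^-1 = a^n, then (a b)^m = a^(geom_sum n m) b^m. *)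
Definition geom_sum (n m : nat) := \sum_(t < m) n ^ t.

Lemma geom_sum_modn n n' m k : n = n' %[mod k] -> geom_sum n m = geom_sum n' m %[mod k].
Proof.
move=> E; rewrite /geom_sum; elim: m => [|m IH]; first by rewrite !big_ord0.
by rewrite !big_ord_recr /= -modnDm IH -(modnXm _ _ n) E modnXm modnDm.
Qed.

Lemma expn_mod_exponent n q k m : n ^ q = 1 %[mod k] -> n ^ m = n ^ (m %% q) %[mod k].
Proof.
move=> nq; rewrite {1}(divn_eq m q) [(m %/ q * q)%N]mulnC expnD expnM.
by rewrite -modnMml -modnXm nq modnXm exp1n modnMml mul1n.
Qed.

(** Multiplication by [i] permutes the residues modulo [q], and n^t modulo [k] depends only on t
    modulo [q]. Hence N is the same for all nontrivial powers of b. *)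
Lemma geom_sum_expn n q i k : prime q -> n ^ q = 1 %[mod k] -> ~~ (q %| i) ->
  geom_sum (n ^ i) q = geom_sum n q %[mod k].
Proof.
move=> prq nq qi; have q0 := prime_gt0 prq.
pose h (t : 'I_q) : 'I_q := Ordinal (ltn_pmod (i * t) q0).
have hI : injective h.
  move=> t u [] E; apply/val_inj.
  wlog le_tu : t u E / t <= u.
    by move=> W; case/orP: (leq_total t u) => le; [|apply/esym]; apply: W.
  move/esym/eqP: E; rewrite eqn_mod_dvd ?leq_mul2l ?le_tu ?orbT // -mulnBr.
  rewrite Euclid_dvdM // (negPf qi) /= => /dvdn_leq; have := ltn_ord u.
  by rewrite subn_gt0 => lt /=; case: (ltnP t u) => [lt2 /(_ isT)|]; lia.
rewrite [in RHS]/geom_sum (reindex_inj hI) /geom_sum.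
elim/big_rec2: _ => // t x y _ E.
by rewrite -modnDm E modnDm -modnDml -expnM (expn_mod_exponent _ nq) modnDml.
Qed.

Lemma geom_sum_dvd n q k : 0 < n -> n ^ q = 1 %[mod k] -> k %| n.-1 * geom_sum n q.
Proof.
move=> n0 nq; rewrite /geom_sum -predn_exp -subn1 -eqn_mod_dvd ?nq //.
by rewrite expn_gt0 n0.
Qed.

Lemma expn_succ_mod d t : exists r, d.+1 ^ t = 1 + t * d + d ^ 2 * r.
Proof.
elim: t => [|t [r IH]]; first by exists 0; rewrite expn0 mul0n muln0.
by exists (t + r + d * r); rewrite expnS IH -mulnn; lia.
Qed.

(** Binomial expansion of ((1 + d)^q - 1) / d modulo d^2. *)
Lemma geom_sum_mod d q : exists r, geom_sum d.+1 q = q + d * 'C(q, 2) + d ^ 2 * r.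
Proof.
rewrite /geom_sum; elim: q => [|q [r IH]]; first by exists 0; rewrite big_ord0 bin0n !muln0.
have [r' E] := expn_succ_mod d q; exists (r + r').
by rewrite big_ord_recr /= IH E binS bin1 -mulnn; lia.
Qed.

Lemma geom_sum_mod_pfactor p e n q :
  prime p -> prime q -> 0 < n -> n ^ q = 1 %[mod p ^ e] ->
  (q = 2 -> p = 2 -> 3 <= e ->
   n <> 2 ^ (e - 1) + 1 %[mod 2 ^ e] /\ n <> 2 ^ (e - 1) - 1 %[mod 2 ^ e]) ->
  (p ^ e %| geom_sum n q) || (geom_sum n q == q %[mod p ^ e]).
Proof.
move=> prp prq n0 nq exc; have := geom_sum_dvd n0 nq.
case: n n0 nq exc => // d _ nq exc /=.
have [->|e0] := posnP e; first by rewrite expn0 !dvd1n.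
have [pd|npd] := boolP (p %| d); last first.
  by rewrite Gauss_dvdr ?coprimeXl ?prime_coprime // => ->.
have [r E] := geom_sum_mod d q.
have [pq|npq] := eqVneq p q; last first.
  have npN : ~~ (p %| geom_sum d.+1 q).
    rewrite E -addnA dvdn_addl; first by rewrite dvdn_prime2.
    by rewrite -mulnn -mulnA -mulnDr dvdn_mulr.
  rewrite mulnC Gauss_dvdr ?coprimeXl ?prime_coprime // => ped.
  apply/orP; right; rewrite E -addnA -mulnn -mulnA -mulnDr.
  by rewrite eqn_mod_dvd ?leq_addr // addKn dvdn_mulr.
subst p; have [q2|nq2] := eqVneq q 2; last first.
  have oq : odd q by have [|//] := even_prime prq; move/eqP; rewrite (negPf nq2).
  have [h Eh] : exists h, 'C(q, 2) = q * h.
    have /dvdnP[h ->] : q %| 'C(q, 2).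
      by rewrite prime_dvd_bin //=; have := prime_gt1 prq; lia.
    by exists h; rewrite mulnC.
  (* q divides the sum exactly once, hence q ^ (e - 1) divides d. *)
  case/dvdnP: pd => f Ed.
  have EN : geom_sum d.+1 q = q * (1 + q * (f * h + f ^ 2 * r)).
    by rewrite E Eh Ed -!mulnn; lia.
  rewrite EN mulnA => H.
  have {H} H : q ^ e %| d * q.
    move: H; rewrite Gauss_dvdl // coprimeXl // prime_coprime //.
    by rewrite dvdn_addl ?dvdn_mulr // dvdn1; have := prime_gt1 prq; lia.
  apply/orP; right; rewrite eqn_mod_dvd; last by rewrite leq_pmulr.
  have -> : q * (1 + q * (f * h + f ^ 2 * r)) - q = d * q * (h + f * r).
    by rewrite mulnDr muln1 addKn Ed -mulnn; lia.
  by rewrite dvdn_mulr.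
subst q; have {E} -> : geom_sum d.+1 2 = d + 2.
  by rewrite /geom_sum !big_ord_recr big_ord0 /= expn0 expn1; lia.
case: e e0 nq exc => // e _ _ exc; rewrite (expnS 2 e).
case/dvdnP: pd => f Ed.
(* Here [e] has been lowered by one, so the modulus is 2 Q. According to the parity of f, Q divides
   2 f = n - 1 or 2 (f + 1) = n + 1. An odd quotient gives an excluded residue, except modulo 2 and
   4, where the parity of f suffices. *)
set Q := 2 ^ e => H.
have HQ : Q %| 2 * f * f.+1.
  have EH : d * (d + 2) = 2 * (2 * f * f.+1) by rewrite Ed; lia.
  by move: H; rewrite EH dvdn_pmul2l.
have exc' : 1 < e -> d.+1 <> Q + 1 %[mod 2 * Q] /\ d.+1 <> Q - 1 %[mod 2 * Q].
  by move=> e1; have := exc erefl erefl e1; rewrite subn1 /= expnS.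
have Qgt0 : 0 < Q by rewrite expn_gt0.
have small : ~~ (1 < e) -> Q = 1 \/ Q = 2.
  by rewrite /Q; case: (e) => [|[|?]] //= _; [left|right].
have copQ y : odd y -> coprime Q y by move=> oy; rewrite coprimeXl // coprime2n.
clear exc H; clearbody Q.
have half w : {v | w = 2 * v} + {v | w = 2 * v + 1}.
  by case/boolP: (odd w) => ow; [right|left]; exists w./2;
    rewrite -{1}[w]odd_double_half -mul2n ?ow ?(negPf ow) // addnC.
have [[u Ef]|[u Ef]] := half f; apply/orP; [right|left].
  have /dvdnP[w Ew] : Q %| 2 * f.
    by move: HQ; rewrite Gauss_dvdl // copQ // Ef /= mul2n odd_double.
  rewrite eqn_mod_dvd ?leq_addl // addnK Ed [f * 2]mulnC.
  have [[v Ev]|[v Ev]] := half w; first by rewrite Ew Ev mulnAC dvdn_mulr.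
  have [e1|e1] := boolP (1 < e); last first.
    case: (small e1) => ->; first by rewrite dvdn_mulr.
    by rewrite Ef mulnA dvdn_mulr.
  case: (exc' e1) => no _; case: no.
  by rewrite Ed [f * 2]mulnC Ew Ev mulnDl mulnAC -addnS mul1n [_ * v]mulnC modnMDl addn1.
have /dvdnP[w Ew] : Q %| 2 * f.+1.
  by move: HQ; rewrite mulnAC Gauss_dvdl // copQ // Ef addn1 /= mul2n odd_double.
have -> : d + 2 = 2 * f.+1 by rewrite Ed [f * 2]mulnC mulnS addnC.
have [[v Ev]|[v Ev]] := half w; first by rewrite Ew Ev mulnAC dvdn_mulr.
have [e1|e1] := boolP (1 < e); last first.
  case: (small e1) => ->; first by rewrite dvdn_mulr.
  by rewrite Ef addn1 -[(2 * u).+2]/(2 + 2 * u) -mulnS mulnA dvdn_mulr.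
case: (exc' e1) => _ [].
have -> : d.+1 = v * (2 * Q) + (Q - 1).
  apply/eqP; rewrite -(eqn_add2r 1) -addnA subnK // !addn1.
  by rewrite Ed mulnC -addn2 -mulnSr Ew Ev mulnDl mul1n -mulnA mulnCA.
by rewrite modnMDl.
Qed.

End GeometricSum.

(** * The presentation and the decomposition of the group *)

Section Presentation.
Local Open Scope group_scope.

(** The automorphism needed to build a concrete model of the group: the n-th power map, whose q-th
    iterate is the identity. *)
Lemma cycle_power_Aut (gT : finGroupType) (z : gT) n q :
  coprime #[z] n -> n ^ q = 1 %[mod #[z]] ->
  exists s, [/\ s \in Aut <[z]>, (#[s] %| q)%N & s z = z ^+ n].
Proof.
move=> cop nq.
have inj : 'injm (cyclem n z).
  apply/injmP => x y zx zy /= E.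
  by rewrite -(expgK cop zx) -[y](expgK cop zy); congr (_ ^+ _).
have im : cyclem n z @* <[z]> = <[z]>.
  by rewrite morphim_cycle ?cycle_id //; apply/esym/eqP; rewrite -generator_coprime in cop.
have As := Aut_aut inj im; exists (aut inj im); split=> //; last by rewrite autE ?cycle_id.
have autX r x : x \in <[z]> -> (aut inj im ^+ r) x = x ^+ (n ^ r).
  elim: r x => [|r IH] x zx; first by rewrite perm1.
  by rewrite expgS permM autE //= IH ?groupX // -expgM -expnS.
rewrite order_dvdn; apply/eqP/(eq_Aut (groupX q As) (group1 _)) => x zx.
rewrite perm1 autX //; apply/eqP; rewrite -[X in _ == X]expg1 eq_expg_mod_order.
by rewrite -(modn_dvdm _ (order_dvdG zx)) nq modn_dvdm ?order_dvdG.
Qed.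

Variables (k q l n : nat).

Lemma homg_semidirectP (rT : finGroupType) (H : {group rT}) :
  reflect (exists a b, [/\ <[a]> <*> <[b]> = H, a ^+ k = 1, b ^+ (q * l) = 1
                         & a ^ b^-1 = a ^+ n])
    (H \homg Grp (a : b : a ^+ k, b ^+ (q * l), b * a * b^-1 = a ^+ n)).
Proof.
apply: (iffP existsP) => [[[a b]] /= /eqP[defH ak bk ab]|[a [b [defH ak bk ab]]]].
  by exists a, b; split=> //; rewrite conjgE invgK mulgA.
exists (a, b); rewrite /= !xpair_eqE defH ak bk !eqxx /=.
by rewrite -ab conjgE invgK mulgA eqxx.
Qed.

Lemma homg_extremalP (rT : finGroupType) (H : {group rT}) :
  reflect (exists a b, [/\ <[a]> <*> <[b]> = H, a ^+ k = 1, b ^+ (q * l) = 1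
                         & a ^ b = a ^+ n])
    (H \homg Grp (x : y : x ^+ k, y ^+ (q * l), x ^ y = x ^+ n)).
Proof.
apply: (iffP existsP) => [[[a b]] /= /eqP[defH ak bk ab]|[a [b [defH ak bk ab]]]].
  by exists a, b.
by exists (a, b); rewrite /= !xpair_eqE defH ak bk ab !eqxx.
Qed.

Lemma homg_semidirect_extremal (rT : finGroupType) (H : {group rT}) :
  (H \homg Grp (a : b : a ^+ k, b ^+ (q * l), b * a * b^-1 = a ^+ n)) =
  (H \homg Grp (x : y : x ^+ k, y ^+ (q * l), x ^ y = x ^+ n)).
Proof.
apply/homg_semidirectP/homg_extremalP => -[a [b [defH ak bk ab]]];
  exists a, b^-1; split=> //; rewrite ?cycleV ?expgVn ?bk ?invg1 ?invgK //.
Qed.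

Hypothesis params : semidirect_params k q l n.

Lemma semidirect_k_gt1 : (1 < k)%N.
Proof.
case: params => -[k0 _ _] _ _ _; case: k k0 => [|[|r]] // _.
by rewrite !modn1.
Qed.

Lemma semidirect_ql_gt1 : (1 < q * l)%N.
Proof.
case: params => -[_ l0 _] /prime_gt1 q1 _ _ _.
by rewrite (leq_trans q1) // leq_pmulr.
Qed.

(** A concrete model. It bounds the order of a presented group from below, and provides the group of
    the counterexample. *)
Lemma is_semidirect_extremal : is_semidirect k q l n (Extremal.gtype k (q * l) n).
Proof.
have k1 := semidirect_k_gt1; have ql1 := semidirect_ql_gt1.
case: params => -[k0 l0 n0] prq _ nq _.
pose z : 'Z_k := Zp1.
have oz : #[z] = k by rewrite order_Zp1 Zp_cast.
have cop : coprime #|<[z]>| n.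
  rewrite -orderE oz coprime_sym; have := coprime_modl (n ^ q) k.
  by rewrite nq coprime_modl coprime1n coprime_pexpl ?prime_gt0.
rewrite /is_semidirect => rT H; rewrite homg_semidirect_extremal.
apply: Extremal.Grp => //.
rewrite -oz in nq; have [s [As os sz]] := cycle_power_Aut cop nq.
by exists s; split=> //; apply: dvdn_trans os (dvdn_mulr _ _).
Qed.

(* If b0 is the second generator of the presentation, then c = b0 ^ q and b is
   the power of b0 of order q that acts on a as b0 does. *)
Lemma semidirect_structure (gT : finGroupType) :
  is_semidirect k q l n gT -> ~~ (q %| l)%N ->
  exists a b c : gT, [/\ #[a] = k, #[b] = q & #[c] = l] /\
    [/\ a ^ b^-1 = a ^+ n, commute c a, commute c b,
        <[a]> :&: <[c]> = 1 & (<[a]> <*> <[c]>) ><| <[b]> = [set: gT]].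
Proof.
move=> isoG ql; have [[k0 l0 n0] prq _ nq _] := params.
have q0 := prime_gt0 prq.
have [a [b0 [defG ak bql ab]]] := homg_semidirectP _ (isoGrp_hom isoG).
(* The concrete model, of order k q l, is a quotient of the group; hence the orders of [a] and [b0]
   cannot drop below k and q l. *)
have geG : (k * (q * l) <= #|[set: gT]|)%N.
  rewrite mulnC -(Extremal.card n semidirect_ql_gt1 semidirect_k_gt1).
  apply: dvdn_leq (cardG_gt0 _) (dvdn_trans (card_homg _) (dvdnn _)).
  by rewrite isoG; apply: isoGrp_hom is_semidirect_extremal.
have le_a : (#[a] <= k)%N by rewrite dvdn_leq // order_dvdn ak.
have le_b : (#[b0] <= q * l)%N by rewrite dvdn_leq ?muln_gt0 ?q0 // order_dvdn bql.
have nab : b0 \in 'N(<[a]>).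
  by rewrite -groupV -cycle_subG norms_cycle ab mem_cycle.
have {defG} defG : <[a]> * <[b0]> = [set: gT].
  by rewrite -defG norm_joinEr // cycle_subG.
have tiab : <[a]> :&: <[b0]> = 1.
  by apply: cardMg_TI; rewrite defG (leq_trans _ geG) // leq_mul.
have [oa ob] : #[a] = k /\ #[b0] = (q * l)%N.
  have := TI_cardMg tiab; rewrite defG -!orderE => E; move: geG; rewrite E => geG.
  have ql0 : (0 < q * l)%N by rewrite muln_gt0 q0.
  have oa0 := order_gt0 a; have ob0 := order_gt0 b0.
  move: (q * l)%N (#[a]) (#[b0]) geG le_a le_b ql0 oa0 ob0 => m u v *; nia.
(* By Fermat, [t] is an inverse of [l] modulo [q], so that b0^(l t) acts on [a] as [b0] does. *)
pose t := (l ^ (q - 2))%N.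
have cql : coprime q l by rewrite prime_coprime.
have lt1 : (l * t = 1 %[mod q])%N.
  rewrite -expnS (_ : (q - 2).+1 = totient q); last first.
    by rewrite totient_prime //; have := prime_gt1 prq; lia.
  by apply: Euler_exp_totient; rewrite coprime_sym.
have cqt : coprime q t by rewrite coprimeXr.
pose c := b0 ^+ q; pose b := b0 ^+ (l * t).
have oc : #[c] = l by rewrite orderXdiv ob ?dvdn_mulr // mulKn.
have obb : #[b] = q.
  by rewrite orderXgcd ob [(q * l)%N]mulnC -muln_gcdr (eqP cqt) muln1 mulKn.
have aX r : a ^ (b0 ^- r) = a ^+ (n ^ r).
  elim: r => [|r IH]; first by rewrite expg0 invg1 conjg1.
  by rewrite expgSr invMg conjgM ab conjXg IH -expgM -expnSr.
have nqX r : (n ^ (q * r) = 1 %[mod k])%N by rewrite expnM -modnXm nq modnXm exp1n.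
have ca : commute c a.
  have : a ^ (c^-1) = a.
    by rewrite aX; apply/eqP; rewrite -[X in _ == X]expg1 eq_expg_mod_order oa nq.
  by rewrite conjgE invgK mulgA => E; rewrite /commute -[in RHS]E mulgKV.
have cb : commute c b by apply: commuteX2.
have ab' : a ^ b^-1 = a ^+ n.
  rewrite aX (divn_eq (l * t) q) lt1 modn_small ?prime_gt1 // addn1 expnS.
  apply/eqP; rewrite eq_expg_mod_order oa -modnMmr [(_ %/ q * q)%N]mulnC nqX.
  by rewrite modnMmr muln1.
have tiac : <[a]> :&: <[c]> = 1.
  by apply/trivgP; rewrite -tiab setIS // cycleX.
exists a, b, c; split; split => //.
have cA : <[a]> <*> <[c]> = <[a]> * <[c]>.
  by rewrite cent_joinEr // cycle_subG; apply/centP => _ /cycleP[i ->]; apply: commuteX.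
have cbI : <[c]> * <[b]> = <[b0]>.
  have cop : coprime #[c] #[b] by rewrite oc obb coprime_sym.
  apply/eqP; rewrite eqEcard mul_subG ?cycleX //= TI_cardMg ?coprime_TIg //.
  by apply: eq_leq; rewrite -[LHS]/#[b0] -[RHS]/(#[c] * #[b])%N oc obb ob mulnC.
have AB : <[a]> <*> <[c]> * <[b]> = [set: gT] by rewrite cA -mulgA cbI.
rewrite sdprodE //.
  apply: normsY; first by rewrite cycle_subG -groupV -cycle_subG norms_cycle ab' mem_cycle.
  by rewrite norms_cycle conjgE cb mulKg cycle_id.
apply: (@cardMg_TI _ (<[a]> <*> <[c]>)%G) => /=.
rewrite AB cA TI_cardMg // -[leqLHS]/(#[a] * #[c] * #[b])%N oa oc obb.
by apply: leq_trans geG; rewrite -mulnA leq_mul // mulnC.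
Qed.

End Presentation.

(** * Computations in the coordinates a^u c^w b^i *)

Section Structure.
Local Open Scope group_scope.
Variables (k q l n : nat) (gT : finGroupType) (a b c : gT).
Hypotheses (k0 : (0 < k)%N) (prq : prime q) (n0 : (0 < n)%N).
Hypothesis nq : (n ^ q = 1 %[mod k])%N.
Hypotheses (oa : #[a] = k) (ob : #[b] = q) (oc : #[c] = l).
Hypotheses (ab : a ^ b^-1 = a ^+ n) (ca : commute c a) (cb : commute c b).
Hypothesis tiac : <[a]> :&: <[c]> = 1.
Hypothesis sdG : (<[a]> <*> <[c]>) ><| <[b]> = [set: gT].
Local Notation A := (<[a]> <*> <[c]>).
Local Notation B := <[b]>.
Let G := geom_sum n q.

Lemma cent_ac : <[c]> \subset 'C(<[a]>).
Proof. by rewrite cent_cycle cycle_subG; apply/cent1P. Qed.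

Lemma mem_acP z : reflect (exists u w, z = a ^+ u * c ^+ w) (z \in A).
Proof.
rewrite cent_joinEr ?cent_ac //; apply: (iffP mulsgP).
  by case=> _ _ /cycleP[u ->] /cycleP[w ->] ->; exists u, w.
by case=> u [w ->]; exists (a ^+ u) (c ^+ w); rewrite ?mem_cycle.
Qed.

Lemma ac_abelian : abelian A.
Proof. by rewrite abelianY !cycle_abelian cent_ac. Qed.

Let cX i j : commute (c ^+ i) (a ^+ j).
Proof. exact: commuteX2. Qed.

Lemma acM u w u' w' : a ^+ u * c ^+ w * (a ^+ u' * c ^+ w') = a ^+ (u + u') * c ^+ (w + w').
Proof. by rewrite !expgD !mulgA -(mulgA _ (c ^+ w)) cX !mulgA. Qed.

Lemma acX u w m : (a ^+ u * c ^+ w) ^+ m = a ^+ (u * m) * c ^+ (w * m).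
Proof. by rewrite expgMn ?expgM //; apply/commute_sym. Qed.

Lemma ac_inj u w u' w' : a ^+ u * c ^+ w = a ^+ u' * c ^+ w' ->
  a ^+ u = a ^+ u' /\ c ^+ w = c ^+ w'.
Proof.
move=> E; have E' : (a ^+ u')^-1 * a ^+ u = c ^+ w' * (c ^+ w)^-1.
  by apply: (mulgI (a ^+ u')); rewrite mulKVg mulgA -E mulgK.
have : (a ^+ u')^-1 * a ^+ u \in <[a]> :&: <[c]>.
  by rewrite inE {2}E' !groupM ?groupV ?mem_cycle.
rewrite tiac inE => /eqP E1; move: E'; rewrite E1 => E2; split.
  by apply: (mulgI (a ^+ u')^-1); rewrite E1 mulVg.
by apply: (mulIg (c ^+ w)^-1); rewrite mulgV.
Qed.

Lemma eq_expg_a i j : (a ^+ i == a ^+ j) = (i == j %[mod k])%N.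
Proof. by rewrite eq_expg_mod_order oa. Qed.

Lemma conj_ab i u : b ^+ i * a ^+ u = a ^+ (u * n ^ i) * b ^+ i.
Proof.
have conj1 v : b * a ^+ v = a ^+ (v * n) * b.
  have -> : a ^+ (v * n) = (a ^+ v) ^ b^-1 by rewrite conjXg ab -!expgM mulnC.
  by rewrite conjgE invgK mulgA mulgKV.
elim: i u => [|i IH] u; first by rewrite expg0 mul1g mulg1 expn0 muln1.
by rewrite expgSr -mulgA conj1 mulgA IH -mulgA -mulnA -expnS.
Qed.

Lemma acbX u w i m : (a ^+ u * c ^+ w * b ^+ i) ^+ m =
  a ^+ (u * geom_sum (n ^ i) m) * c ^+ (w * m) * b ^+ (i * m).
Proof.
elim: m => [|m IH]; first by rewrite /geom_sum big_ord0 !muln0 !expg0 !mulg1.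
have bz : b ^+ (i * m) * (a ^+ u * c ^+ w) = a ^+ (u * n ^ (i * m)) * c ^+ w * b ^+ (i * m).
  by rewrite mulgA conj_ab -!mulgA (commuteX2 _ _ cb).
rewrite expgSr IH !mulgA -(mulgA _ _ (a ^+ u)) -(mulgA _ _ (c ^+ w)) -(mulgA (b ^+ _)) bz.
rewrite !mulgA -(mulgA (_ * _) (a ^+ _)) acM -mulgA -expgD.
by rewrite /geom_sum big_ord_recr /= mulnDr -expnM !mulnSr.
Qed.

Lemma acN_pow u w i : ~~ (q %| i)%N ->
  (a ^+ u * c ^+ w * b ^+ i) ^+ q = a ^+ (u * G) * c ^+ (w * q).
Proof.
move=> qi; rewrite acbX expgM [(i * q)%N]mulnC.
have -> : b ^+ (q * i) = 1 by rewrite expgM -ob expg_order expg1n.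
rewrite mulg1; congr (_ * _); apply/eqP; rewrite -expgM eq_expg_a -modnMmr.
by rewrite (geom_sum_expn prq nq qi) modnMmr.
Qed.

(** Let M = n^(i m) be the exponent by which b^(i m) acts. As m is invertible modulo [q], n^i is a
    power of M modulo [k], so the geometric sum is, modulo [k], m plus a multiple of M - 1.
    Conjugation by a^v changes the exponent of [a] by v (M - 1), which absorbs that multiple. *)
Lemma acb_powJ m u w i : ~~ (q %| m)%N ->
  exists v, (a ^+ u * c ^+ w * b ^+ i) ^+ m =
            ((a ^+ u * c ^+ w) ^+ m * (b ^+ i) ^+ m) ^ v.
Proof.
move=> qm; have cop : coprime m q by rewrite coprime_sym prime_coprime.
have [j mj] : exists j, (m * j = 1 %[mod q])%N.
  exists (m ^ (totient q).-1)%N; rewrite -expnS prednK ?totient_gt0 ?prime_gt0 //.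
  exact: Euler_exp_totient.
pose M := (n ^ (i * m))%N.
have niM : (n ^ i = M ^ j %[mod k])%N.
  rewrite -expnM (expn_mod_exponent i nq) [in RHS](expn_mod_exponent _ nq).
  by rewrite -mulnA -modnMmr mj modnMmr muln1.
have M0 : (0 < M)%N by rewrite expn_gt0 n0.
have [s Es] : exists s, geom_sum (M ^ j) m = (m + M.-1 * s)%N.
  have Mj0 : (0 < M ^ j)%N by rewrite expn_gt0 M0.
  have [r] := geom_sum_mod (M ^ j).-1 m; rewrite (prednK Mj0) predn_exp => ->.
  by rewrite -mulnn -addnA -!mulnA -!mulnDr; eexists.
exists (a ^+ (u * s)); apply: (mulgI (a ^+ (u * s))).
rewrite acbX acX -expgM conjgE mulKVg -!mulgA conj_ab -/M.
rewrite (mulgA (c ^+ _) (a ^+ _) (b ^+ _)) cX !mulgA -!expgD; congr (_ * _ * _).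
apply/eqP; rewrite eq_expg_a -modnDmr -modnMmr (geom_sum_modn m niM) Es.
by rewrite modnMmr modnDmr; apply/eqP; congr (_ %% _)%N; rewrite -{2}(prednK M0); lia.
Qed.

Lemma geom_sum_fixed u : (u * G * n = u * G %[mod k])%N.
Proof.
have /dvdnP[t Et] := geom_sum_dvd n0 nq.
by rewrite -{1}(prednK n0) mulnS -mulnA [(G * _)%N]mulnC Et mulnA addnC modnMDl.
Qed.

(** On the powers of [c] the map N is the q-th power, and on each primary part of [<[a]>] it is
    trivial or the q-th power. Where it is the q-th power, the terms in z of the equation of [Nsolv]
    cancel and leave N(g')^j = 1. *)
Lemma sdprod_indicator_ge0 (F : numFieldType) (V : fdmodule (drinfeld_double F gT)) m :
  (forall p, p \in \pi(k) -> (k`_p %| G)%N || (G == q %[mod k`_p])%N) ->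
  (0 <= indicator m V)%R.
Proof.
move=> partk; pose N z := (z * b) ^+ q.
have q1 := prime_gt1 prq; have nq1 : ~~ (q %| 1)%N by rewrite dvdn1; case: eqP q1 => // ->.
have NE u w : N (a ^+ u * c ^+ w) = a ^+ (u * G) * c ^+ (w * q).
  by rewrite /N -(acN_pow _ _ nq1) expg1.
have NA : {in A, forall z, N z \in A}.
  by move=> _ /mem_acP[u [w ->]]; rewrite NE; apply/mem_acP; do 2!eexists.
have Bpow y : y \in B -> y != 1 -> exists2 i, y = b ^+ i & ~~ (q %| i)%N.
  by case/cycleP=> i -> bi1; exists i => //; rewrite -ob order_dvdn.
apply: (@indicator_ge0 _ _ V (<[a]> <*> <[c]>)%G <[b]>%G q N) => //.
- exact: ac_abelian.
- move=> _ _ /mem_acP[u [w ->]] /mem_acP[u' [w' ->]].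
  by rewrite acM !NE acM !mulnDl.
- move=> z Az x; have [z1 [y [Az1 By -> _]]] := mem_sdprod sdG (in_setT x).
  apply: commute_sym; apply: commuteM.
    by apply: (centsP ac_abelian); rewrite ?NA.
  case/cycleP: By => i ->; apply: commuteX.
  case/mem_acP: Az => u [w ->]; rewrite NE; apply: commute_sym.
  apply: commuteM; last exact: commuteX (commute_sym cb).
  rewrite /commute -{1}[b]expg1 conj_ab expn1; congr (_ * _).
  by apply/eqP; rewrite eq_expg_a geom_sum_fixed.
- move=> _ y /mem_acP[u [w ->]] By y1; have [i -> qi] := Bpow y By y1.
  by rewrite NE acN_pow.
- move=> j _ _ /mem_acP[u [w ->]] /mem_acP[u' [w' ->]].
  rewrite !NE !acX acM => /ac_inj[/eqP Ea /eqP Ec].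
  have -> : c ^+ (w' * q * j) = 1.
    apply: (mulgI (c ^+ (w * (q * j)))); rewrite -expgD mulg1.
    by rewrite -(eqP Ec) mulnA.
  rewrite mulg1; apply/eqP; rewrite -(expg0 a) eq_expg_a mod0n -[_ == _]/(_ %| _)%N.
  apply/dvdn_partP => // p pk; have [/orP[PG|PG]] := partk p pk.
    by rewrite mulnAC dvdn_mull.
  have {}Ea : (u * G * j = u * (q * j) + u' * G * j %[mod k`_p])%N.
    move/eqP: Ea => /eqP; rewrite eq_expg_a => /eqP.
    by move/(congr1 (fun v => v %% k`_p)%N) => /=; rewrite !modn_dvdm ?dvdn_part.
  have {}PG : (u * G * j = u * (q * j) %[mod k`_p])%N.
    by rewrite -mulnA -modnMmr -[(G * j %% _)%N]modnMml (eqP PG) modnMml modnMmr.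
  by move/eqP: Ea; rewrite PG -[X in X == _ %[mod _]]addn0 eqn_modDl mod0n eq_sym.
move=> m' _ _ qm /mem_acP[u [w ->]] /cycleP[i ->] _.
exact: acb_powJ.
Qed.

End Structure.

(** * Induced modules *)

Section LeftIdeal.
Local Open Scope ring_scope.
Variables (F : fieldType) (gT : finGroupType).
Notation D := (drinfeld_double F gT).
Variable U : {vspace D}.

Definition left_ideal_mul (x : D) (v : subvs_of U) : subvs_of U :=
  vsproj U (x * vsval v).

Lemma left_ideal_mul_is_linear x : linear (left_ideal_mul x).
Proof.
move=> t v w; rewrite /left_ideal_mul -linearP; congr (vsproj U _).
by rewrite linearP /= mulrDr -scalerAr.
Qed.
HB.instance Definition _ x := GRing.isSemilinear.Build F (subvs_of U) (subvs_of U) *:%R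
  (left_ideal_mul x) (GRing.semilinear_linear (left_ideal_mul_is_linear x)).

Definition left_ideal_act (x : D) : 'End(subvs_of U) := linfun (left_ideal_mul x).

Lemma left_ideal_act_is_linear : linear left_ideal_act.
Proof.
move=> t x y; apply/lfunP => v; rewrite !lfunE /= lfunE /= !lfunE /= /left_ideal_mul.
by rewrite mulrDl -scalerAl linearP.
Qed.
HB.instance Definition _ := GRing.isSemilinear.Build F D 'End(subvs_of U) *:%R
  left_ideal_act (GRing.semilinear_linear left_ideal_act_is_linear).

Hypothesis idU : forall x v : D, v \in U -> x * v \in U.

Lemma left_ideal_actE x v : vsval (left_ideal_act x v) = x * vsval v.
Proof. by rewrite lfunE /= vsprojK ?idU ?subvsP. Qed.

Lemma left_ideal_act1 : left_ideal_act 1 = \1%VF.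
Proof. by apply/lfunP => v; apply: val_inj; rewrite /= left_ideal_actE mul1r lfunE. Qed.

Lemma left_ideal_actM x y : left_ideal_act (x * y) = (left_ideal_act x \o left_ideal_act y)%VF.
Proof.
by apply/lfunP => v; apply: val_inj; rewrite /= left_ideal_actE comp_lfunE !left_ideal_actE mulrA.
Qed.

Definition left_ideal_module : fdmodule D := FdModule left_ideal_act1 left_ideal_actM.
End LeftIdeal.

(** * Irreducible modules induced from a centralizer *)

Section InducedModule.
Local Open Scope ring_scope.
Variables (F : numFieldType) (gT : finGroupType) (g : gT) (rho : gT -> F).
Notation D := (drinfeld_double F gT).
Notation B g x := (dd_basis F (g%g, x%g)).
Notation Cg := ('C[g])%g.
Hypothesis rhoM : {in Cg &, forall x y, rho (x * y)%g = rho x * rho y}.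
Hypothesis rho1 : rho 1%g = 1.

Let cardC : #|Cg|%:R != 0 :> F.
Proof. by rewrite pnatr_eq0 -lt0n cardG_gt0. Qed.

Lemma dd_sum_basis (v : D) : v = \sum_u v u *: dd_basis F u.
Proof.
apply/ffunP => u; rewrite sum_ffunE (bigD1 u) //= !ffunE eqxx [_ *: 1]mulr1 big1 ?addr0 //.
by move=> w wu; rewrite !ffunE eq_sym (negPf wu) [_ *: 0]mulr0.
Qed.

(** The idempotent of the linear character [rho] of the centralizer of [g], placed in degree [g];
    the left ideal that it generates is the induced module. *)
Definition induced_idem : D := #|Cg|%:R^-1 *: \sum_(y in Cg) rho y^-1%g *: B g y.
Notation e := induced_idem.

Lemma dd_basis_idem y : y \in Cg -> B g y * e = rho y *: e.
Proof.
move=> Cy; rewrite /e -scalerAr scalerA mulrC -scalerA; congr (_ *: _).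
rewrite mulr_sumr scaler_sumr [RHS](reindex_inj (mulgI y)) /=.
apply: eq_big => [z|z Cz]; first by rewrite groupMl.
rewrite -scalerAr scalerA invMg rhoM ?groupV // mulrCA -rhoM ?groupV // mulgV rho1 mulr1.
by rewrite dd_basis_pairM (cent1P Cy) mulgK eqxx.
Qed.

Lemma induced_idemM : e * e = e.
Proof.
rewrite {1}/e -scalerAl mulr_suml (eq_bigr (fun=> e)) => [|y Cy].
  by rewrite sumr_const -scaler_nat scalerA mulVf // scale1r.
by rewrite -scalerAl dd_basis_idem // scalerA -rhoM ?groupV // mulVg rho1 scale1r.
Qed.

Lemma dd_basis1_idem : B g 1 * e = e.
Proof. by rewrite dd_basis_idem ?group1 // rho1 scale1r. Qed.

Lemma dd_basis_idem0 x : x \notin Cg -> B g x * e = 0.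
Proof.
move=> nCx; rewrite -dd_basis1_idem mulrA dd_basis_pairM ifN ?mul0r //.
by apply: contra nCx => /eqP E; apply/cent1P; rewrite /commute [in RHS]E mulgKV.
Qed.

(** The product of p_g >< 1, p_h >< x and [e] vanishes unless h = g and x centralizes g, and is then
    rho(x) e. So the degree g part of the left ideal is the line of [e]. *)
Lemma dd_basis_line (v : D) : v * e = v -> exists t, B g 1 * v = t *: e.
Proof.
move=> ve; exists (\sum_(x in Cg) v (g, x) * rho x).
rewrite -{1}ve mulrA {1}(dd_sum_basis v) mulr_sumr mulr_suml scaler_suml [RHS]big_mkcond.
transitivity (\sum_h \sum_x v (h, x) *: (B g 1 * B h x * e)).
  rewrite [RHS](pair_bigA _ (fun h x => v (h, x) *: (B g 1 * B h x * e))).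
  apply: eq_bigr => -[h x] _ /=.
  by rewrite -(scalerAr _ (B g 1)) -scalerAl.
rewrite (bigD1 g) //= [X in _ + X]big1 ?addr0 => [|h hg]; last first.
  by apply: big1 => x _; rewrite dd_basis_pairM mul1g invg1 mulg1 eq_sym (negPf hg) mul0r scaler0.
apply: eq_bigr => x _; rewrite dd_basis_pairM mul1g invg1 mulg1 eqxx mul1g.
by case: ifP => Cx; [rewrite dd_basis_idem // scalerA | rewrite dd_basis_idem0 ?Cx // scaler0].
Qed.

Definition mulr_idem (v : D) : D := v * e.

Lemma mulr_idem_is_linear : linear mulr_idem.
Proof. by move=> t v w; rewrite /mulr_idem mulrDl scalerAl. Qed.
HB.instance Definition _ := GRing.isSemilinear.Build F D D *:%R
  mulr_idem (GRing.semilinear_linear mulr_idem_is_linear).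

Definition induced_space : {vspace D} := limg (linfun mulr_idem).
Notation U := induced_space.

Lemma mem_induced v : v \in U = (v * e == v).
Proof.
apply/memv_imgP/eqP => [[w _ ->]|ve]; last by exists v; rewrite ?memvf // lfunE.
by rewrite lfunE /= /mulr_idem -mulrA induced_idemM.
Qed.

Lemma induced_ideal (x v : D) : v \in U -> x * v \in U.
Proof. by rewrite !mem_induced -mulrA => /eqP->. Qed.

Definition induced_module : fdmodule D := left_ideal_module induced_ideal.

Lemma induced_actE x (v : fdmod_space induced_module) :
  vsval (fdmod_act induced_module x v) = x * vsval v.
Proof. exact: left_ideal_actE induced_ideal x v. Qed.

Lemma idem_in : e \in U.
Proof. by rewrite mem_induced induced_idemM. Qed.

Lemma induced_idemE h z :
  e (h, z) = #|Cg|%:R^-1 * (if (h == g) && (z \in Cg) then rho z^-1%g else 0).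
Proof.
rewrite ffunE sum_ffunE; congr (_ * _).
have [Cz|nCz] := boolP (z \in Cg); last first.
  rewrite andbF big1 // => y Cy; rewrite !ffunE xpair_eqE.
  have -> : (z == y) = false by apply/negbTE; apply: contra nCz => /eqP->.
  by rewrite andbF [_ *: 0]mulr0.
rewrite (bigD1 z) //= big1 ?addr0 => [|y /andP[_ yz]]; last first.
  by rewrite !ffunE xpair_eqE [z == y]eq_sym (negPf yz) andbF [_ *: 0]mulr0.
rewrite !ffunE xpair_eqE eqxx !andbT; case: eqP => _; first by rewrite [_ *: 1]mulr1.
by rewrite [_ *: 0]mulr0.
Qed.

Lemma idem_neq0 : e != 0.
Proof.
apply/eqP => /ffunP/(_ (g, 1%g)); rewrite induced_idemE eqxx group1 /= invg1 rho1 mulr1.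
by rewrite ffunE => /eqP; rewrite invr_eq0 (negPf cardC).
Qed.

Lemma induced_support (v : D) h x : v * e = v -> v (h, x) != 0 -> h = (x * g * x^-1)%g.
Proof.
move=> ve; apply: contraNeq => hx; rewrite -ve [X in X == _]dd_mulE big1 // => y _.
rewrite induced_idemE; case: ifP => [|_]; last by rewrite !mulr0.
case/andP=> /eqP Eg /cent1P; rewrite -Eg => Ec; case/eqP: hx.
have : (y^-1 * h * x = y^-1 * x * (y^-1 * h * y))%g.
  by have := Ec; rewrite /commute !mulgA mulgK.
by rewrite Eg -!(mulgA y^-1)%g => /mulgI <-; rewrite mulgK.
Qed.

(** A nonzero [v] has a nonzero coefficient at some (x g x^-1, x). Multiplication by p_g >< x^-1
    turns it into a nonzero element of degree g, a multiple of the idempotent, and the idempotent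
    generates the module. *)
Lemma induced_irreducible : irreducible_module induced_module.
Proof.
split.
  move/eqP; rewrite dimv_eq0 => /eqP E.
  have : vsproj U e \in (fullv : {vspace fdmod_space induced_module}) by rewrite memvf.
  rewrite E memv0 => /eqP/(congr1 vsval); rewrite vsprojK ?idem_in //= => /eqP.
  by rewrite (negPf idem_neq0).
move=> W stW; have [->|W0] := eqVneq W 0%VS; [by left|right].
have := memv_pick W; have : vpick W != 0 by rewrite vpick0.
set v := vpick W => v0 Wv.
have ve : vsval v * e = vsval v by apply/eqP; rewrite -mem_induced subvsP.
have [x nz] : exists x, B g x^-1 * vsval v != 0.
  have [[h x] hx] : exists u, vsval v u != 0.
    apply/existsP; apply: contraR v0 => /existsPn v0; apply/eqP/val_inj/ffunP => u.
    by rewrite [RHS]ffunE; apply/eqP; rewrite -[_ == _]negbK v0.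
  exists x; apply: contra hx => /eqP/ffunP/(_ (g, 1%g)).
  rewrite [X in X = _ -> _]dd_mulE (bigD1 x^-1%g) //= big1 ?addr0 => [|y yx]; last first.
    by rewrite ffunE xpair_eqE (negPf yx) andbF mul0r.
  rewrite !ffunE eqxx mul1r invgK mulg1 => E0.
  have [//|hx] := boolP (vsval v (h, x) == 0).
  by have Eh := induced_support ve hx; move: hx; rewrite Eh E0 eqxx.
have [|t] := @dd_basis_line (B g x^-1 * vsval v); first by rewrite -mulrA ve.
rewrite mulrA dd_basis_pairM mul1g invg1 mulg1 eqxx mul1g => Et.
have t0 : t != 0 by apply: contra nz => /eqP t0; rewrite Et t0 scale0r.
have We : vsproj U e \in W.
  suff -> : vsproj U e = fdmod_act induced_module (t^-1 *: B g x^-1) v by apply: stW.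
  apply: val_inj; rewrite /= induced_actE vsprojK ?idem_in // -scalerAl Et.
  by rewrite scalerA mulVf // scale1r.
apply/eqP; rewrite eqEsubv subvf; apply/subvP => w _.
suff -> : w = fdmod_act induced_module (vsval w) (vsproj U e) by apply: stW.
apply: val_inj; rewrite /= induced_actE vsprojK ?idem_in //.
by apply/esym/eqP; rewrite -mem_induced subvsP.
Qed.

Lemma induced_char y : y \in Cg -> module_character induced_module (B g y) = rho y.
Proof.
move=> Cy; apply: (@lftrace_line _ _ _ (vsproj U e)).
- apply/eqP => /(congr1 vsval); rewrite vsprojK ?idem_in //= => /eqP.
  by rewrite (negPf idem_neq0).
- move=> v; apply/vlineP.
  have [|t Et] := @dd_basis_line (vsval v).
    by apply/eqP; rewrite -mem_induced subvsP.
  exists (t * rho y); apply: val_inj; rewrite /= induced_actE.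
  have -> : B g y = B g y * B g 1 by rewrite dd_basis_pairM (cent1P Cy) mulgK eqxx mulg1.
  by rewrite -mulrA Et -scalerAr dd_basis_idem // scalerA vsprojK ?idem_in.
by apply: val_inj; rewrite /= induced_actE vsprojK ?idem_in // dd_basis_idem.
Qed.

Lemma induced_char0 h y : h \notin (g ^: [set: gT])%g ->
  module_character induced_module (B h y) = 0.
Proof.
move=> hg; suff E : fdmod_act induced_module (B h y) = 0.
  by rewrite /module_character E lftrace0.
apply/lfunP => v; apply: val_inj; rewrite /= induced_actE lfunE /=.
have ve : vsval v * e = vsval v by apply/eqP; rewrite -mem_induced subvsP.
apply/ffunP => -[h' x]; rewrite [LHS]dd_mulE [RHS]ffunE big1 // => z _.
rewrite ffunE xpair_eqE; case: eqP => [->|]; last by rewrite mul0r.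
have [->|nz] := eqVneq (vsval v ((z^-1 * h * z)%g, (z^-1 * x)%g)) 0; first by rewrite mulr0.
case/negP: hg; apply/imsetP; exists (x^-1)%g; rewrite ?inE //.
have := induced_support ve nz => /(congr1 (fun w => z * w * z^-1)%g).
by rewrite invMg invgK !mulgA mulgV !mul1g !mulgK => ->; rewrite conjgE invgK mulgA.
Qed.

(** Only the degrees conjugate to [g] contribute, all of them equally. Their number is the index of
    the centralizer, which turns 1/|G| into 1/|C(g)|. *)
Lemma induced_indicator m : indicator m induced_module =
  #|Cg|%:R^-1 * \sum_(x | ((g * x^-1) ^+ m * x ^+ m == 1)%g) rho (x ^+ m)%g.
Proof.
rewrite indicatorE (bigID (mem (g ^: [set: gT])%g)) /= [X in _ + X]big1 ?addr0; last first.
  by move=> h hg; rewrite /local_indicator big1 // => x _; apply: induced_char0.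
rewrite (eq_bigr (fun=> local_indicator induced_module m g)); last first.
  by move=> _ /imsetP[y _ ->]; apply: local_indicatorJ.
rewrite sumr_const -[_ *+ #|_|]mulr_natl mulrA; congr (_ * _).
  have cl0 : #|(g ^: [set: gT])%g|%:R != 0 :> F.
    by rewrite pnatr_eq0 -lt0n; apply/card_gt0P; exists g; apply: class_refl.
  rewrite -cardsT -(Lagrange (subsetT Cg)) natrM.
  have := index_cent1 [set: gT]%G g; rewrite setTI => ->.
  by rewrite invfM -mulrA mulVf // mulr1.
apply: eq_bigr => x /eqP/indicator_cond_commute cgx; apply: induced_char.
exact/cent1P/commute_sym.
Qed.

End InducedModule.

(** * A sign character and its second indicator *)

Section SignCharacter.
Local Open Scope ring_scope.
Variables (F : numClosedFieldType) (gT : finGroupType) (r : nat) (t : gT).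
Notation Z := ('Z([set: gT]))%g.
Hypothesis powZ : {in Z, forall z, z ^+ r = 1 \/ z ^+ r = t}%g.
Hypothesis tt : (t * t = 1)%g.

Lemma centralZ z x : z \in Z -> commute z x.
Proof. by case/centerP => _ cz; apply: cz; rewrite inE. Qed.

(** The r-th power maps the centre into {1, t}; for t <> 1 it is followed here by the character of
    {1, t} with value -1 at t. *)
Definition signZ (z : gT) : F := if (z ^+ r == 1)%g then 1 else -1.

Lemma signZ1 : signZ 1%g = 1.
Proof. by rewrite /signZ expg1n eqxx. Qed.

Lemma signZM : {in Z &, forall x y, signZ (x * y)%g = signZ x * signZ y}.
Proof.
move=> x y Zx Zy; rewrite /signZ expgMn; last exact: centralZ.
case: (powZ Zx) => ->; first by rewrite mul1g eqxx mul1r.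
case: (powZ Zy) => ->; first by rewrite mulg1 eqxx mulr1.
by rewrite tt eqxx; case: eqP => _; rewrite ?mulr1 // mulrNN mulr1.
Qed.

Lemma signZX m : {in Z, forall z, signZ (z ^+ m)%g = signZ z ^+ m}.
Proof.
move=> z Zz; elim: m => [|m IH]; first by rewrite signZ1.
by rewrite expgS exprS signZM ?groupX // IH.
Qed.

Lemma signZ_sqr z : signZ z * signZ z = 1.
Proof. by rewrite /signZ; case: ifP => _; rewrite ?mulrNN mulr1. Qed.

Variable g : gT.
Hypothesis centg : {in 'C[g], forall y, y \in Z \/ (g^-1 * y) \in Z}%g.
Hypothesis gZ : g \notin Z.

Let ggZ : (g * g)%g \in Z.
Proof.
have [||] // := @centg (g * g)%g; first by rewrite groupM ?cent1id.
by rewrite mulKg (negPf gZ).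
Qed.

(** The centralizer of [g] is the union of Z and g Z, so an extension is determined by its value at
    [g], whose square must be the sign of g^2. *)
Definition sign_ext (y : gT) : F :=
  if y \in Z then signZ y else sqrtC (signZ (g * g)%g) * signZ (g^-1 * y)%g.

Lemma sign_extM : {in 'C[g]%g &, forall x y, sign_ext (x * y)%g = sign_ext x * sign_ext y}.
Proof.
have nZ z : z \in Z -> (g * z)%g \notin Z by move=> Zz; rewrite groupMr.
have ext z : z \in Z -> sign_ext (g * z)%g = sqrtC (signZ (g * g)%g) * signZ z.
  by move=> Zz; rewrite /sign_ext (negPf (nZ z Zz)) mulKg.
have extZ z : z \in Z -> sign_ext z = signZ z by move=> Zz; rewrite /sign_ext Zz.
have form y : y \in 'C[g]%g -> y \in Z \/ exists2 z, z \in Z & y = (g * z)%g.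
  move=> /centg[Zy|Zgy]; [by left|right].
  by exists (g^-1 * y)%g; rewrite ?mulKVg.
move=> x y /form[Zx|[z Zz ->]] /form[Zy|[z' Zz' ->]].
- by rewrite !extZ ?groupM // signZM.
- by rewrite mulgA (centralZ g Zx) -mulgA !ext ?groupM // extZ // (signZM Zx Zz') mulrCA.
- by rewrite -mulgA !ext ?groupM // extZ // (signZM Zz Zy) mulrA.
rewrite mulgA -(mulgA g) (centralZ g Zz) !mulgA -mulgA.
rewrite (extZ _ (groupM ggZ (groupM Zz Zz'))) (signZM ggZ (groupM Zz Zz')).
rewrite (signZM Zz Zz') !ext // [RHS]mulrACA.
by congr (_ * _); rewrite -expr2 sqrtCK.
Qed.

Lemma sign_ext1 : sign_ext 1%g = 1.
Proof. by rewrite /sign_ext group1 signZ1. Qed.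

Definition sign_module : fdmodule (drinfeld_double F gT) :=
  induced_module sign_extM sign_ext1.

Lemma indicator2_condE x : ((g * x^-1) ^+ 2 * x ^+ 2 == 1)%g = (g ^ x == g^-1)%g.
Proof.
rewrite !expgS !expg0 !mulg1 !mulgA mulgKV -(inj_eq (mulgI g^-1)%g) !mulgA.
by rewrite mulg1 mulVg mul1g conjgE mulgA.
Qed.

Lemma inverting_cent x0 x : (g ^ x0 = g^-1)%g ->
  (g ^ x == g^-1)%g = (x * x0^-1 \in 'C[g])%g.
Proof.
move=> gx0; have -> u : (u \in 'C[g])%g = (g ^ u == g)%g.
  by rewrite cent1E -[RHS](inj_eq (mulgI u)) conjgE mulKVg eq_sym.
by rewrite conjgM -[RHS](inj_eq (@conjg_inj _ x0)) conjgKV gx0.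
Qed.

(** An inverting x is y x0 with y in Z or in g Z. As (g x0)^2 = x0^2, in both cases x^2 is x0^2
    times the square of a central element, and such squares have sign 1. *)
Lemma sign_inverting x0 x : (g ^ x0 = g^-1)%g -> (x0 * x0)%g \in Z ->
  ((x0 * x0) ^+ r != 1)%g -> (g ^ x = g^-1)%g ->
  (x * x)%g \in Z /\ signZ (x * x)%g = -1.
Proof.
move=> gx0 Zx0 x0r gx.
suff [z Zz ->] : exists2 z, z \in Z & (x * x = z * z * (x0 * x0))%g.
  have Zzz := groupM Zz Zz; have ZxZ := groupM Zzz Zx0; split=> //.
  by rewrite (signZM Zzz Zx0) (signZM Zz Zz) signZ_sqr mul1r /signZ (negPf x0r).
have Cy : (x * x0^-1)%g \in 'C[g]%g by rewrite -inverting_cent // gx.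
have {Cy} [Zy|Zy] := centg Cy.
  move: Zy (mulgKV x0 x); move: (x * x0^-1)%g => y Zy <-; exists y => //.
  by rewrite -!mulgA (mulgA x0 y) -(centralZ x0 Zy) !mulgA.
move: Zy (mulgKV x0 x) (mulKVg g (x * x0^-1))%g.
move: (x * x0^-1)%g => y; move: (g^-1 * y)%g => z Zz <- <-; exists z => //.
have E : (g * x0 * (g * x0) = x0 * x0)%g.
  have H : (g * x0 = x0 * g^-1)%g by rewrite -gx0 conjgE mulKVg.
  by rewrite {1}H -mulgA mulKg.
rewrite -E -(centralZ g Zz) -!mulgA (mulgA x0 z) -(centralZ x0 Zz) -mulgA.
by rewrite (mulgA g z) -(centralZ g Zz) !mulgA.
Qed.

(** The elements inverting [g] form a coset of its centralizer, and each contributes -1. *)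
Lemma indicator2_sign x0 : (g ^ x0 = g^-1)%g -> (x0 * x0)%g \in Z ->
  ((x0 * x0) ^+ r != 1)%g -> indicator 2 sign_module = -1.
Proof.
move=> gx0 Zx0 x0r; rewrite induced_indicator (eq_bigr (fun=> -1)) => [|x].
  rewrite sumr_const mulNrn mulrN; congr (- _).
  rewrite (_ : #|_| = #|'C[g]%g|) ?mulVf // ?pnatr_eq0 -?lt0n ?cardG_gt0 //.
  rewrite -(card_rcoset _ x0); apply: eq_card => x.
  by rewrite mem_rcoset -inverting_cent // -indicator2_condE.
rewrite indicator2_condE => /eqP gx; have [Zx sx] := sign_inverting gx0 Zx0 x0r gx.
by rewrite expgS expg1 /sign_ext Zx.
Qed.

Lemma indicator_sign_lt0 m : (exists x, (g * x^-1) ^+ m * x ^+ m = 1)%g ->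
  (forall x, (g * x^-1) ^+ m * x ^+ m = 1 -> x ^+ m \in Z /\ signZ (x ^+ m)%g = -1)%g ->
  indicator m sign_module < 0.
Proof.
move=> [x0 Ex0] Hm; rewrite induced_indicator (eq_bigr (fun=> -1)); last first.
  by move=> x /eqP/Hm[Zx sx]; rewrite /sign_ext Zx.
rewrite sumr_const mulNrn mulrN oppr_lt0 mulr_gt0 ?invr_gt0 ?ltr0n ?cardG_gt0 //.
by apply/card_gt0P; exists x0; apply/eqP.
Qed.

Lemma indicator_sign0 m : (forall x, (g * x^-1) ^+ m * x ^+ m <> 1)%g ->
  indicator m sign_module = 0.
Proof.
by move=> Hm; rewrite induced_indicator big1 ?mulr0 // => x /eqP/Hm.
Qed.
End SignCharacter.

(** * The exceptional residues *)

Section Exceptional.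
Local Open Scope group_scope.
(* If n = 2 ^ (s - 1) + 1 modulo 2 ^ s then f = s - 1, and if
   n = 2 ^ (s - 1) - 1 then f = 1. *)
Variables (s x l n f o o' : nat) (gT : finGroupType) (a b c : gT).
Let k := (2 ^ s * x)%N.
Hypotheses (oddx : odd x) (oddl : odd l) (f0 : (0 < f)%N) (fs : (f < s)%N).
Hypotheses (nE : n = (2 ^ f * o + 1)%N) (nE' : (n.+1 * 2 ^ f.-1 = 2 ^ s.-1 * o')%N).
Hypotheses (oddo : odd o) (oddo' : odd o').
Hypotheses (oa : #[a] = k) (ob : #[b] = 2) (oc : #[c] = l).
Hypotheses (ab : a ^ b^-1 = a ^+ n) (ca : commute c a) (cb : commute c b).
Hypothesis sdG : (<[a]> <*> <[c]>) ><| <[b]> = [set: gT].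
Local Notation Z := 'Z([set: gT]).
(** Central elements are of the form a^u c^w with 2^(s-f) dividing u. The r-th power kills c^w and,
    as 2^(s-f) r = 2^(s-1) x l, sends a^u to a power of the involution [tau]. *)
Let r := (2 ^ f.-1 * x * l)%N.
(** For g = a^u0 b and x0 = a^u1, inversion of g by x0 amounts to u1 (n - 1) + u0 (n + 1) = 0 modulo
    [k]. *)
Let u0 := (x * 2 ^ f.-1)%N.
Let u1 := (x * 2 ^ (s - f).-1)%N.
Let tau := a ^+ (2 ^ s.-1 * x).

Let eqa i j : (a ^+ i == a ^+ j) = (i == j %[mod k])%N.
Proof. exact: eq_expg_a oa i j. Qed.

Let ba u : b * a ^+ u = a ^+ (u * n) * b.
Proof. by have := conj_ab ab 1 u; rewrite expn1 expg1. Qed.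

Let bb : b * b = 1.
Proof. by have := expg_order b; rewrite ob expgS expg1. Qed.

Let xgt0 : (0 < x)%N. Proof. by case: x oddx. Qed.

Let s2 : (2 ^ s = 2 * 2 ^ s.-1)%N.
Proof. by rewrite -expnS prednK // (leq_trans _ fs). Qed.

Let sf : (2 ^ s = 2 ^ f * 2 ^ (s - f))%N.
Proof. by rewrite -expnD subnKC // ltnW. Qed.

Let sf1 : (2 ^ s.-1 = 2 ^ f * 2 ^ (s - f).-1)%N.
Proof. by rewrite -expnD; congr (2 ^ _)%N; move: f0 fs; clear; lia. Qed.

Let sf2 : (2 ^ s.-1 = 2 ^ f.-1 * 2 ^ (s - f))%N.
Proof. by rewrite -expnD; congr (2 ^ _)%N; move: f0 fs; clear; lia. Qed.

Lemma fixed_dvd u : (u * n == u %[mod k])%N -> (2 ^ (s - f) %| u)%N.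
Proof.
rewrite nE mulnDr muln1 -[X in _ == X %[mod _]]add0n eqn_modDr mod0n -[_ == _]/(_ %| _)%N.
move=> /(dvdn_trans (dvdn_mulr x (dvdnn _))); rewrite sf mulnCA dvdn_pmul2l ?expn_gt0 //.
by rewrite Gauss_dvdl // coprimeXl // coprime2n.
Qed.

Let n1 : ~~ (n == 1 %[mod k])%N.
Proof.
apply/negP; rewrite -{1}[n]mul1n => /fixed_dvd; rewrite dvdn1.
by rewrite -(subnSK fs) expnS muln_eq1.
Qed.

Lemma gen_form y : exists u w, y = a ^+ u * c ^+ w \/ y = a ^+ u * c ^+ w * b.
Proof.
have [z [v [Az Bv -> _]]] := mem_sdprod sdG (in_setT y).
have [u [w ->]] := mem_acP ca _ Az; exists u, w.
case/cycleP: Bv => i ->; rewrite -(odd_double_half i) expgD -mul2n expgM expgS expg1 bb.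
by rewrite expg1n mulg1; case: (odd i); [right|left]; rewrite ?expg1 ?expg0 ?mulg1.
Qed.

Lemma ac_central u w : (u * n = u %[mod k])%N -> a ^+ u * c ^+ w \in Z.
Proof.
move=> /eqP un; apply/centerP; split; first by rewrite inE.
move=> y _; have ac u' w' : commute (a ^+ u * c ^+ w) (a ^+ u' * c ^+ w').
  by rewrite /commute !(acM ca) addnC [(w + _)%N]addnC.
have [u' [w' [|] ->]] := gen_form y; first exact: ac.
apply: commuteM => //; apply: commute_sym; rewrite /commute mulgA ba -!mulgA.
by rewrite -(commuteX w (commute_sym cb)) !mulgA -eqa in un *; rewrite (eqP un).
Qed.

Let gM u w u' w' : a ^+ u * c ^+ w * b * (a ^+ u' * c ^+ w') =
  a ^+ (u + u' * n) * c ^+ (w + w') * b.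
Proof.
rewrite -(acM ca) -!mulgA; congr (_ * (_ * _)); rewrite !mulgA ba -!mulgA; congr (_ * _).
exact: commuteX (commute_sym cb).
Qed.

Lemma not_central u w : a ^+ u * c ^+ w * b \notin Z.
Proof.
apply: contra n1 => Zg; have := centralZ (a ^+ 1 * c ^+ 0) Zg.
rewrite /commute gM (mulgA (a ^+ 1 * _)) (acM ca).
move/mulIg; rewrite addn0 add0n => /mulIg/eqP.
by rewrite eqa addnC eqn_modDr mul1n.
Qed.

Lemma commute_central u w u' w' : commute (a ^+ u * c ^+ w * b) (a ^+ u' * c ^+ w') ->
  (u' * n == u' %[mod k])%N.
Proof.
rewrite /commute gM (mulgA (a ^+ u' * _)) (acM ca) addnC [(w + _)%N]addnC => /mulIg/mulIg/eqP.
by rewrite eqa eqn_modDr.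
Qed.

Lemma central_form z : z \in Z ->
  exists u w, z = a ^+ u * c ^+ w /\ (2 ^ (s - f) %| u)%N.
Proof.
move=> Zz; have [u [w [] Ez]] := gen_form z; last first.
  by move: Zz; rewrite Ez (negPf (not_central u w)).
exists u, w; split=> //; apply: fixed_dvd.
by apply: (@commute_central 0 0 _ w); rewrite -Ez; apply/commute_sym/centralZ.
Qed.

Lemma tau_sqr : tau * tau = 1.
Proof. by rewrite /tau -expgD addnn -mul2n mulnA -s2 -/k -oa expg_order. Qed.

Lemma central_pow : {in Z, forall z, z ^+ r = 1 \/ z ^+ r = tau}.
Proof.
move=> z /central_form[u [w [-> /dvdnP[v ->]]]]; rewrite (acX ca).
have -> : c ^+ (w * r) = 1 by rewrite /r mulnA mulnC expgM -oc expg_order expg1n.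
have -> : (v * 2 ^ (s - f) * r = 2 ^ s.-1 * x * (v * l))%N by rewrite /r sf2; clear; lia.
rewrite mulg1 expgM -/tau -(odd_double_half (v * l)) expgD -mul2n expgM expgS expg1 tau_sqr.
by rewrite expg1n mulg1; case: (odd _); [right; rewrite expg1|left].
Qed.

(** An element of A that commutes with an element of A b commutes with b, hence is central. If y
    lies outside A, this applies to g^-1 y, which lies in A. *)
Lemma cent_split u w : {in 'C[a ^+ u * c ^+ w * b], forall y,
  y \in Z \/ (a ^+ u * c ^+ w * b)^-1 * y \in Z}.
Proof.
set g := _ * b; move=> y /cent1P/commute_sym cgy; have [u' [w' [] Ey]] := gen_form y.
  by left; rewrite Ey ac_central //; apply/eqP/(@commute_central u w _ w'); rewrite -Ey.
right; have Ay : g^-1 * y \in <[a]> <*> <[c]>.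
  have [/andP[_ nA] _ _ _ _] := sdprod_context sdG.
  rewrite Ey /g invMg -mulgA (mulgA _ _ b) -conjgE memJ_norm ?(subsetP nA) ?inE //.
  by rewrite groupM ?groupV //; apply/(mem_acP ca); do 2!eexists.
have cgt : commute g (g^-1 * y) by apply: commuteM => //; apply: commuteV.
have [u2 [w2 E2]] := mem_acP ca _ Ay; rewrite E2 in cgt *.
exact/ac_central/eqP/(commute_central cgt).
Qed.

(** Both u1 (n - 1) and u0 (n + 1) are odd multiples of k / 2, with factors [o] and [o'], so their
    sum is 0 modulo [k]. *)
Lemma inverting_u1 : (a ^+ u0 * b) ^ (a ^+ u1) = (a ^+ u0 * b)^-1.
Proof.
have E : a ^+ u0 * b * a ^+ u1 * (a ^+ u0 * b) = a ^+ u1.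
  rewrite -!mulgA (mulgA (a ^+ u1)) -expgD (mulgA b) ba -mulgA bb mulg1 -expgD.
  apply/eqP; rewrite eqa.
  have [h oo] : exists h, (o + o' = h + h)%N.
    by exists (o + o')./2; rewrite addnn even_halfK // oddD oddo oddo'.
  have -> : (u0 + (u1 + u0) * n = k * h + u1)%N.
    have E1 : (u1 * n = u1 + 2 ^ s.-1 * x * o)%N by rewrite nE sf1 /u1; clear; lia.
    have E2 : (u0 + u0 * n = 2 ^ s.-1 * x * o')%N.
      by rewrite -mulnS /u0 -mulnA [(_ * n.+1)%N]mulnC nE'; clear; lia.
    rewrite mulnDl addnCA E2 E1 -addnA -mulnDr oo /k s2; clear; lia.
  by rewrite mulnC modnMDl.
rewrite conjgE; apply: (mulIg (a ^+ u0 * b)); rewrite mulVg.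
by rewrite -!mulgA; apply: (mulgI (a ^+ u1)); rewrite mulKVg mulg1 !mulgA in E *.
Qed.

Lemma u1_sqr_central : a ^+ u1 * a ^+ u1 \in Z.
Proof.
rewrite -expgD -[_ ^+ _]mulg1 -(expg0 c) ac_central //.
have -> : ((u1 + u1) * n = o * k + (u1 + u1))%N.
  by rewrite nE /u1 /k s2 sf1; clear; lia.
by rewrite modnMDl.
Qed.

Lemma u1_sqr_pow : (a ^+ u1 * a ^+ u1) ^+ r != 1.
Proof.
rewrite -expgD -expgM -(expg0 a) eqa mod0n -[_ == _]/(_ %| _)%N.
have -> : ((u1 + u1) * r = 2 ^ s.-1 * x * (x * l))%N.
  by rewrite /u1 /r sf2 -(subnSK fs) expnS /=; clear; lia.
rewrite /k s2 -(mulnA 2) [(_ * (x * l))%N]mulnC dvdn_pmul2r ?muln_gt0 ?expn_gt0 ?xgt0 //.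
by rewrite dvdn2 oddM oddx oddl.
Qed.

Lemma exceptional_indicator (F : numClosedFieldType) :
  exists W : fdmodule (drinfeld_double F gT),
    irreducible_module W /\ indicator 2 W = (-1)%R.
Proof.
have cs := @cent_split u0 0; have nc := not_central u0 0.
rewrite expg0 mulg1 in cs nc.
exists (sign_module F central_pow tau_sqr cs nc); split.
  exact: induced_irreducible.
exact: (indicator2_sign _ _ _ _ _ inverting_u1 u1_sqr_central u1_sqr_pow).
Qed.

Let c_central : c \in Z.
Proof. by have := @ac_central 0 1; rewrite expg0 expg1 mul1g mul0n; apply. Qed.

Lemma sqr_form y : exists u w, y ^+ 2 = a ^+ u * c ^+ w.
Proof.
have [u [w [] ->]] := gen_form y; first by rewrite (acX ca); do 2!eexists.
by exists (u + u * n)%N, (w + w)%N; rewrite expgS expg1 mulgA gM -mulgA bb mulg1.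
Qed.

(** The order of a^u0 b divides 2 k, so the 2k-th powers of both sides give c^(2 k j) = 1, and [l]
    is prime to 2 k. *)
Lemma inverting_twist x' j : coprime l k ->
  (a ^+ u0 * b) ^ x' = (a ^+ u0 * b)^-1 * c ^+ j -> (l %| j)%N.
Proof.
move=> colk; set g := a ^+ u0 * b => E.
have gk : g ^+ (2 * k) = 1.
  rewrite expgM expgS expg1 /g -!mulgA (mulgA b) ba -mulgA bb mulg1 -expgD -expgM mulnC expgM.
  by rewrite -oa expg_order expg1n.
have := congr1 (expgn^~ (2 * k)%N) E; rewrite /= -conjXg gk conj1g expgMn; last first.
  exact/commute_sym/centralZ/groupX.
rewrite expgVn gk invg1 mul1g -expgM => /esym/eqP; rewrite -order_dvdn oc.
by rewrite Gauss_dvdl // coprimeMr colk coprime_sym coprime2n oddl.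
Qed.

(** Take g = g0 c. As c is central, the condition for 2 is g0^y = g0^-1 c^-2, which
    [inverting_twist] excludes because l does not divide 2. Squares lie in A, so the condition for 2
    l is that g0 g0^y c^2 has trivial l-th power; it is then a power of c, which forces g0^y =
    g0^-1, and y^(2 l) has sign (-1)^l = -1. *)
Lemma twisted_indicator (F : numClosedFieldType) : coprime l k -> (1 < l)%N ->
  exists W : fdmodule (drinfeld_double F gT),
    [/\ irreducible_module W, (indicator (2 * l) W < 0)%R & indicator 2 W = 0%R].
Proof.
move=> colk l1; have cs := @cent_split u0 1; have nc := not_central u0 1.
have cs0 := @cent_split u0 0; have nc0 := not_central u0 0.
rewrite expg0 mulg1 in cs0 nc0.
pose g0 := a ^+ u0 * b; pose g := a ^+ u0 * c ^+ 1 * b.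
have gE : g = g0 * c by rewrite /g expg1 -!mulgA cb.
have cC y : commute c y by apply: centralZ.
have sqE y : (g * y^-1) ^+ 2 * y ^+ 2 = g0 * g0 ^ y * c ^+ 2.
  have -> : g * y^-1 = g0 * y^-1 * c by rewrite gE -!mulgA cC.
  rewrite expgMn; last exact/commute_sym.
  rewrite -mulgA (commuteX2 2 2 (cC y)) mulgA conjgE !expgS expg0 !mulg1.
  by rewrite !mulgA mulgKV.
have powE y : (g * y^-1) ^+ (2 * l) * y ^+ (2 * l) = (g0 * g0 ^ y * c ^+ 2) ^+ l.
  have cA : commute ((g * y^-1) ^+ 2) (y ^+ 2).
    have [[u [w ->]] [u' [w' ->]]] := (sqr_form (g * y^-1), sqr_form y).
    by rewrite /commute !(acM ca) [(u' + _)%N]addnC [(w' + _)%N]addnC.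
  by rewrite (expgM (g * y^-1) 2 l) (expgM y 2 l) -sqE (expgMn _ cA).
have c2l : c ^+ 2 * c ^+ (2 * l.-1) = 1.
  by rewrite -expgD -mulnS prednK ?(ltnW l1) // mulnC expgM -oc expg_order expg1n.
have twist y j : g0 * g0 ^ y * c ^+ 2 = c ^+ j -> (l %| j + 2 * l.-1)%N.
  move=> E; apply: (@inverting_twist y) => //.
  by rewrite -/g0 expgD -E -mulgA c2l mulg1 mulKg.
exists (sign_module F central_pow tau_sqr cs nc); split.
- exact: induced_irreducible.
- apply: indicator_sign_lt0 => [|y].
    exists (a ^+ u1); rewrite -/g powE inverting_u1 mulgV mul1g -expgM mulnC expgM.
    by rewrite -oc expg_order expg1n.
  rewrite -/g powE.
  have [[u [w E1]] [u' [w' E2]]] := (sqr_form (g * y^-1), sqr_form y).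
  rewrite -sqE E1 E2 (acM ca) (acX ca) => El.
  have cW : c ^+ ((w + w') * l) = 1 by rewrite mulnC expgM -oc expg_order expg1n.
  have aU : a ^+ (u + u') = 1.
    apply/eqP; rewrite -order_dvdn oa; move: El; rewrite cW mulg1 => /eqP.
    by rewrite -order_dvdn oa Gauss_dvdl // coprime_sym.
  have E : g0 * g0 ^ y * c ^+ 2 = c ^+ (w + w') by rewrite -sqE E1 E2 (acM ca) aU mul1g.
  have gy : g0 ^ y = g0^-1.
    have /dvdnP[j Ej] := twist y _ E.
    apply: (mulgI g0); rewrite mulgV; apply: (mulIg (c ^+ 2)); rewrite E mul1g.
    apply: (mulIg (c ^+ (2 * l.-1))); rewrite c2l -expgD Ej mulnC expgM.
    by rewrite -oc expg_order expg1n.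
  have [Zy sy] := sign_inverting F central_pow tau_sqr cs0 inverting_u1 u1_sqr_central u1_sqr_pow gy.
  have -> : y ^+ (2 * l) = (y * y) ^+ l by rewrite expgM expgS expg1.
  by rewrite groupX // (signZX F central_pow tau_sqr l Zy) sy -signr_odd oddl.
apply: indicator_sign0 => y; rewrite -/g sqE => E.
have := twist y 0 E; rewrite add0n Gauss_dvdr ?coprimen2 //.
by move/dvdn_leq; case: l l1 => [|[|?]] //= _ /(_ isT); rewrite ltnn.
Qed.

End Exceptional.

(** * The two cases and the counterexample *)

Section MainCases.
Local Open Scope nat_scope.

(** With n = 2^(s-1) + 1 + 2^s v or n = 2^(s-1) - 1 + 2^s v, the factors of n - 1 and n + 1 can be
    read off; as s >= 3, the number 2^(s-2) is even, which makes the cofactors odd. In the proof P =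
    2^(s-3). *)
Lemma exceptional_residue s n : 3 <= s ->
  n = 2 ^ (s - 1) + 1 %[mod 2 ^ s] \/ n = 2 ^ (s - 1) - 1 %[mod 2 ^ s] ->
  exists f o o', [/\ 0 < f < s, n = 2 ^ f * o + 1, n.+1 * 2 ^ f.-1 = 2 ^ s.-1 * o',
    odd o & odd o'].
Proof.
case: s => [|[|[|t]]] // _; rewrite subn1 /= !expnS.
have [P EP] : exists P, 2 ^ t = P by eexists.
have P0 : 0 < P by rewrite -EP expn_gt0.
rewrite !EP.
case=> E; have := divn_eq n (2 * (2 * (2 * P))); rewrite E modn_small; try lia.
  move: (n %/ _) => v nE; exists t.+2, (1 + 2 * v), (1 + 2 * P * (1 + 2 * v)); split.
  - by rewrite /= ltnS leqnn.
  - by rewrite nE !expnS EP; clear; lia.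
  - by rewrite nE /= !expnS EP; clear; lia.
  - by rewrite oddD oddM.
  - by rewrite oddD -mulnA oddM.
move: (n %/ _) => v nE; exists 1, (2 * P - 1 + 4 * P * v), (1 + 2 * v); split=> //.
- by rewrite nE; move: P0; clear; lia.
- by rewrite nE /= expn0; move: P0; clear; lia.
- by rewrite -mulnA oddD oddM oddB ?oddM //; lia.
by rewrite oddD oddM.
Qed.

Variable F : numClosedFieldType.

Lemma nonexceptional_indicator_ge0 k q l n s x (gT : finGroupType)
    (V : fdmodule (drinfeld_double F gT)) m :
  semidirect_params k q l n -> is_semidirect k q l n gT -> ~~ (q %| l) ->
  k = 2 ^ s * x -> ~~ (2 %| x) ->
  ~ [/\ q = 2, 3 <= s &
      n = 2 ^ (s - 1) + 1 %[mod 2 ^ s] \/ n = 2 ^ (s - 1) - 1 %[mod 2 ^ s]] ->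
  (0 <= indicator m V)%R.
Proof.
move=> par iso ql kE x2 nexc; have [[k0 l0 n0] prq _ nq _] := par.
have [a [b [c [[oa ob oc] [ab ca cb tiac sdG]]]]] := semidirect_structure par iso ql.
apply: (sdprod_indicator_ge0 k0 prq n0 nq oa ob oc ab ca cb tiac sdG) => p.
rewrite mem_primes => /and3P[prp _ pk]; rewrite p_part.
apply: geom_sum_mod_pfactor => //.
  have dk := pfactor_dvdnn p k.
  by rewrite -(modn_dvdm (n ^ q) dk) nq modn_dvdm.
move=> q2 p2; subst q p.
have -> : logn 2 k = s.
  rewrite kE lognM ?expn_gt0 //; last by case: (x) x2.
  by rewrite pfactorK // lognE (negPf x2) andbF addn0.
by move=> s3; split=> E; apply: nexc; split=> //; [left|right].
Qed.

Lemma exceptional_indicator2 k q l n s x (gT : finGroupType) :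
  semidirect_params k q l n -> is_semidirect k q l n gT -> ~~ (q %| l) ->
  k = 2 ^ s * x -> ~~ (2 %| x) ->
  [/\ q = 2, 3 <= s &
      n = 2 ^ (s - 1) + 1 %[mod 2 ^ s] \/ n = 2 ^ (s - 1) - 1 %[mod 2 ^ s]] ->
  exists W : fdmodule (drinfeld_double F gT), irreducible_module W /\ indicator 2 W = (-1)%R.
Proof.
move=> par iso ql kE x2 [q2 s3 nE]; have [[k0 l0 n0] prq _ nq _] := par.
have [a [b [c [[oa ob oc] [ab ca cb tiac sdG]]]]] := semidirect_structure par iso ql.
have [f [o [o' [/andP[f0 fs] E1 E2 oddo oddo']]]] := exceptional_residue s3 nE.
subst q k; rewrite dvdn2 negbK in x2; rewrite dvdn2 negbK in ql.
exact: (exceptional_indicator x2 ql f0 fs E1 E2 oddo oddo' oa ob oc ab ca cb sdG F).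
Qed.

(** The group is the product of the semidihedral group of order 16 and a cyclic group of order 3,
    and 3 = 2^2 - 1 is an exceptional residue modulo 8. *)
Lemma semidihedral_params : semidirect_params 8 2 3 3.
Proof.
split=> //.
by rewrite (_ : Zp 8 = <[Zp1 : 'Z_8]>%g) ?card_Aut_cycle ?order_Zp1 // -Zp_cycle.
Qed.

Lemma semidihedral_twisted (gT : finGroupType) : is_semidirect 8 2 3 3 gT ->
  exists W : fdmodule (drinfeld_double F gT),
    [/\ irreducible_module W, (indicator 6 W < 0)%R & indicator 2 W = 0%R].
Proof.
move=> iso.
have [a [b [c [[oa ob oc] [ab ca cb tiac sdG]]]]] := semidirect_structure semidihedral_params iso isT.
exact: (@twisted_indicator 3 1 3 3 1 1 1 _ a b c).
Qed.

End MainCases.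

Local Open Scope ring_scope.

Theorem corollary4p10 (R : realType) :
  (forall (k q l n s x : nat) (gT : finGroupType),
     semidirect_params k q l n ->
     is_semidirect k q l n gT ->
     ~~ (q %| l)%N ->
     k = (2 ^ s * x)%N ->
     ~~ (2 %| x)%N ->
     ((exists (m : nat) (V : fdmodule (drinfeld_double R[i] gT)),
         [/\ (0 < m)%N, irreducible_module V & indicator m V < 0])
      <->
      (exists W : fdmodule (drinfeld_double R[i] gT),
         irreducible_module W /\ indicator 2 W = -1))
     /\
     ((exists W : fdmodule (drinfeld_double R[i] gT),
         irreducible_module W /\ indicator 2 W = -1)
      <->
      [/\ q = 2%N, (3 <= s)%N
        & n = 2 ^ (s - 1) + 1 %[mod 2 ^ s] \/ n = 2 ^ (s - 1) - 1 %[mod 2 ^ s]]))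
  /\
  (exists (k q l n : nat) (gT : finGroupType),
     [/\ semidirect_params k q l n,
         is_semidirect k q l n gT,
         ~~ (q %| l)%N
       & exists (m : nat) (W : fdmodule (drinfeld_double R[i] gT)),
           [/\ (0 < m)%N, irreducible_module W, indicator m W < 0
             & indicator 2 W <> -1]]).
Proof.
split=> [k q l n s x gT par iso ql kE x2|]; last first.
  exists 8%N, 2%N, 3%N, 3%N, (Extremal.gtype 8 (2 * 3) 3).
  have iso := is_semidirect_extremal semidihedral_params.
  split=> //; first exact: semidihedral_params.
  have [W [irrW W6 W2]] := semidihedral_twisted R[i] iso.
  exists 6%N, W; split=> //; rewrite W2 => /eqP.
  by rewrite eq_sym oppr_eq0 oner_eq0.
pose exc := [/\ q = 2%N, (3 <= s)%N &
  n = 2 ^ (s - 1) + 1 %[mod 2 ^ s] \/ n = 2 ^ (s - 1) - 1 %[mod 2 ^ s]].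
have to2 : exc -> exists W : fdmodule (drinfeld_double R[i] gT),
    irreducible_module W /\ indicator 2 W = -1.
  exact: exceptional_indicator2 par iso ql kE x2.
have toexc m (V : fdmodule (drinfeld_double R[i] gT)) : indicator m V < 0 -> exc.
  move=> V0.
  (* As [exc] is decidable, it may be proved by contradiction. *)
  have excP : reflect exc [&& q == 2%N, (3 <= s)%N &
      (n == 2 ^ (s - 1) + 1 %[mod 2 ^ s])%N || (n == 2 ^ (s - 1) - 1 %[mod 2 ^ s])%N].
    apply: (iffP and3P) => -[] => [/eqP q2 s3 /orP E|-> s3 E]; split=> //.
      by case: E => /eqP; [left|right].
    by apply/orP; case: E => ->; [left|right].
  apply/excP/negPn/negP => /excP nexc.
  have := nonexceptional_indicator_ge0 V m par iso ql kE x2 nexc.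
  by rewrite (lt_geF V0).
have neg1 : -1 < 0 :> R[i] by rewrite ltrN10.
split; split.
- by move=> [m [V [_ _ /toexc]]].
- by move=> [W [irrW W2]]; exists 2%N, W; split=> //; rewrite W2.
- by move=> [W [_ W2]]; apply: (toexc 2 W); rewrite W2.
exact: to2.
Qed.
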